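(* Let $\Gamma$ be a groupoid, $e,e'\in\Gamma_0$, let $D,D'$ be $\Gamma$-graded division rings with $\operatorname{supp}(D)\subseteq e\Gamma e$ and $\operatorname{supp}(D')\subseteq e'\Gamma e'$, and let $\overline{\sigma}=(\sigma_i)_{i\in I}\in(e\Gamma)^I$ and $\overline{\delta}=(\delta_i)_{i\in I'}\in(e'\Gamma)^{I'}$ be $d$-finite sequences. Then $\mathrm{M}_I(D)(\overline{\sigma})\cong_{gr}\mathrm{M}_{I'}(D')(\overline{\delta})$ if and only if there exist a bijection $\pi:I\to I'$ and $\tau\in e'\Gamma e$ such that $D'\cong_{gr}\mathrm{M}_1(D)(\tau^{-1})$ and $\delta_{\pi(i)}\in\tau(\operatorname{supp}D)\sigma_i$ for each $i\in I$.
   Context: A groupoid $\Gamma$ is a small category with all morphisms invertible, identified with its set of morphisms; $\Gamma_0$ is its set of objects (identified with identity morphisms). For $\gamma:e\to f$ write $d(\gamma)=e$, $r(\gamma)=f$; $\delta\gamma$ is defined iff $d(\delta)=r(\gamma)$. $e\Gamma=\{\gamma:r(\gamma)=e\}$, $e\Gamma f=\{\gamma:r(\gamma)=e,d(\gamma)=f\}$. For $X\subseteq\Gamma$, $\tau X\sigma=\{\tau\alpha\sigma:\alpha\in X,\ \tau\alpha\sigma\text{ defined}\}$. A $\Gamma$-graded ring is an associative ring $R=\bigoplus_{\gamma\in\Gamma}R_\gamma$ (additive subgroups) with $R_\gamma R_\delta\subseteq R_{\gamma\delta}$ if $\gamma\delta$ is defined and $R_\gamma R_\delta=0$ otherwise,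 assumed object unital: for each $e\in\Gamma_0$, $R_e$ is a unital ring with identity $1_e$ (possibly $0$) and $1_{r(\gamma)}a=a=a1_{d(\gamma)}$ for $a\in R_\gamma$. $\operatorname{supp}(R)=\{\gamma:R_\gamma\ne0\}$. $\cong_{gr}$ means there is a degree-preserving ring isomorphism. A $\Gamma$-graded division ring is a $\Gamma$-graded ring $D\neq0$ such that each nonzero $a\in D_\gamma$ has $a^{-1}\in D_{\gamma^{-1}}$ with $aa^{-1}=1_{r(\gamma)}$, $a^{-1}a=1_{d(\gamma)}$. The index sets $I,I'$ are non-empty. A sequence $(\sigma_i)_{i\in I}\in(e\Gamma)^I$ is $d$-finite if for each $f\in\Gamma_0$ only finitely many $i$ satisfy $d(\sigma_i)=f$. For such a sequence and $D$ with $\operatorname{supp}(D)\subseteq e\Gamma e$, $\mathrm{M}_I(D)(\overline{\sigma})$ denotes the ring of $I\times I$ matrices over $D$ with finitely many nonzero entries, $\Gamma$-graded by letting the component of degree $\gamma$ be the set of matrices whose $(i,j)$ entry lies in $D_{\sigma_i\gamma\sigma_j^{-1}}$ for all $i,j$ (with $D_{\sigma_i\gamma\sigma_j^{-1}}=\{0\}$ if $\sigma_i\gamma\sigma_j^{-1}$ is not defined). $\mathrm{M}_1(D)(\tau^{-1})$ is the case of $1\times1$ matrices with the sequence consisting of $\tau^{-1}$, i.e. the ring $D$ with $\gamma$-component $D_{\tau^{-1}\gamma\tau}$. *)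

(* Defs.v *)
From HB Require Import structures.
From mathcomp Require Import all_boot all_order all_algebra.
From mathcomp Require Import mathcomp_extra boolp classical_sets functions.
From mathcomp Require Import cardinality fsbigop.

Set Implicit Arguments.
Unset Strict Implicit.
Unset Printing Implicit Defensive.

Import GRing.Theory.
Local Open Scope classical_set_scope.
Local Open Scope ring_scope.

(* [gcomp g h] is the product g h, i.e. h followed by g, which is defined when
   [dom g = cod h].  The function is total, but unconstrained (and never used)
   outside that case. *)
Record groupoid := Groupoid {
  obj : Type;
  mor :> choiceType;
  dom : mor -> obj;
  cod : mor -> obj;
  idm : obj -> mor;
  gcomp : mor -> mor -> mor;
  ginv : mor -> mor;
  dom_idm : forall e, dom (idm e) = e;
  cod_idm : forall e, cod (idm e) = e;
  dom_gcomp : forall g h, dom g = cod h -> dom (gcomp g h) = dom h;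
  cod_gcomp : forall g h, dom g = cod h -> cod (gcomp g h) = cod g;
  gcompA : forall g h k, dom g = cod h -> dom h = cod k ->
    gcomp g (gcomp h k) = gcomp (gcomp g h) k;
  gcomp1m : forall g, gcomp (idm (cod g)) g = g;
  gcompm1 : forall g, gcomp g (idm (dom g)) = g;
  dom_ginv : forall g, dom (ginv g) = cod g;
  cod_ginv : forall g, cod (ginv g) = dom g;
  gcompVm : forall g, gcomp (ginv g) g = idm (dom g);
  gcompmV : forall g, gcomp g (ginv g) = idm (cod g)
}.

Definition composable (G : groupoid) (g h : G) : Prop := dom g = cod h.

Definition gcomp3 (G : groupoid) (g h k : G) : G := gcomp (gcomp g h) k.

Definition composable3 (G : groupoid) (g h k : G) : Prop :=
  composable g h /\ composable h k.

(* The set e G f of morphisms from f to e. *)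
Definition homset (G : groupoid) (e f : obj G) : set G :=
  [set g | cod g = e /\ dom g = f].

(* The set {t a s : a in X, t a s defined}. *)
Definition translate (G : groupoid) (t : G) (X : set G) (s : G) : set G :=
  [set g | exists a, [/\ X a, composable3 t a s & g = gcomp3 t a s]].

(* Associative rings, not assumed to have an identity. *)
HB.mixin Record Zmodule_isRng V of GRing.Zmodule V := {
  rmul : V -> V -> V;
  rmulA : associative rmul;
  rmulDl : left_distributive rmul +%R;
  rmulDr : right_distributive rmul +%R
}.

#[short(type="rngType")]
HB.structure Definition Rng := {R of GRing.Zmodule R & Zmodule_isRng R}.

Section RngTheory.
Context (R : rngType).
Implicit Types a b : R.

Lemma rmul0r b : rmul 0 b = 0.
Proof. by apply: (@addrI _ (rmul 0 b)); rewrite -rmulDl !addr0. Qed.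

Lemma rmulr0 a : rmul a 0 = 0.
Proof. by apply: (@addrI _ (rmul a 0)); rewrite -rmulDr !addr0. Qed.

Lemma rmul_suml (J : Type) (s : seq J) (F : J -> R) b :
  rmul (\sum_(k <- s) F k) b = \sum_(k <- s) rmul (F k) b.
Proof.
apply: (big_morph (rmul^~ b)); last exact: rmul0r.
by move=> x y; rewrite rmulDl.
Qed.

Lemma rmul_sumr (J : Type) (s : seq J) (F : J -> R) a :
  rmul a (\sum_(k <- s) F k) = \sum_(k <- s) rmul a (F k).
Proof.
apply: (big_morph (rmul a)); last exact: rmulr0.
by move=> x y; rewrite rmulDr.
Qed.

End RngTheory.

Section GradedRings.
Context (G : groupoid).

(* [one e] is the identity 1_e of the component of degree e; the third field
   says that R is the direct sum of its components. *)
Record graded_ring (R : rngType) (deg : G -> set R) (one : obj G -> R) : Prop :=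
  GradedRing {
  deg_0 : forall g, deg g 0;
  deg_sub : forall g a b, deg g a -> deg g b -> deg g (a - b);
  deg_direct_sum : forall x : R, exists! c : G -> R,
    [/\ finite_set [set g | c g != 0],
        forall g, deg g (c g) &
        x = \sum_(g \in [set: G]) c g];
  deg_mul : forall g h a b, composable g h ->
    deg g a -> deg h b -> deg (gcomp g h) (rmul a b);
  deg_mul0 : forall g h a b, ~ composable g h ->
    deg g a -> deg h b -> rmul a b = 0;
  deg_one : forall e, deg (idm e) (one e);
  mul_one_l : forall g a, deg g a -> rmul (one (cod g)) a = a;
  mul_one_r : forall g a, deg g a -> rmul a (one (dom g)) = a
}.

Definition graded_division_ring (D : rngType) (deg : G -> set D) : Prop :=
  exists one : obj G -> D,
    [/\ graded_ring deg one,
        exists x : D, x != 0 &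
        forall g a, deg g a -> a != 0 ->
          exists b, [/\ deg (ginv g) b,
                        rmul a b = one (cod g) &
                        rmul b a = one (dom g)]].

Definition supp (R : rngType) (deg : G -> set R) : set G :=
  [set g | exists2 a, deg g a & a != 0].

Definition gr_isom (R S : rngType) (degR : G -> set R) (degS : G -> set S) :
    Prop :=
  exists f : {additive R -> S},
    [/\ bijective f,
        {morph f : a b / rmul a b} &
        forall g a, degR g a -> degS g (f a)].

Definition d_finite (I : choiceType) (sigma : I -> G) : Prop :=
  forall f : obj G, finite_set [set i | dom (sigma i) = f].

End GradedRings.

Section FiniteMatrices.
Context (I : choiceType) (D : rngType).

Definition fmx_pred : pred (I -> I -> D) :=
  [pred A | `[< finite_set [set p : I * I | A p.1 p.2 != 0] >]].

Lemma fmx_zmod_closed : zmod_closed fmx_pred.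
Proof.
split=> [|A B /asboolP fA /asboolP fB]; apply/asboolP.
  by apply: (@sub_finite_set _ _ set0) => // p /=; rewrite eqxx.
have fAB : finite_set ([set p : I * I | A p.1 p.2 != 0]
                       `|` [set p | B p.1 p.2 != 0]).
  by rewrite finite_setU.
apply: sub_finite_set fAB => p /=; rewrite /GRing.add /GRing.opp /= => nz.
have [A0|] := eqVneq (A p.1 p.2) 0; last by left.
right; apply: contra nz => /eqP B0.
by change (A p.1 p.2 - B p.1 p.2 == 0); rewrite A0 B0 subr0.
Qed.

HB.instance Definition _ :=
  GRing.isZmodClosed.Build (I -> I -> D) fmx_pred fmx_zmod_closed.

(* I x I matrices over D with finitely many nonzero entries. *)
Record fmx := FMx { fmx_val :> I -> I -> D; _ : fmx_val \in fmx_pred }.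

HB.instance Definition _ := [isSub for fmx_val].
HB.instance Definition _ := [Choice of fmx by <:].
HB.instance Definition _ := [SubChoice_isSubZmodule of fmx by <:].

Lemma fmxP (A B : fmx) : (forall i j, A i j = B i j) -> A = B.
Proof. by move=> AB; apply: val_inj; apply/funext=> i; apply/funext. Qed.

Lemma fmx_finite (A : fmx) : finite_set [set p : I * I | A p.1 p.2 != 0].
Proof. by case: A => A /= /asboolP. Qed.

Lemma fmx_seqP (A : fmx) : exists s : seq I,
  forall i j, A i j != 0 -> i \in s /\ j \in s.
Proof.
have /finite_seqP[t tE] := fmx_finite A.
exists (map fst t ++ map snd t) => i j nz.
have ijt : (i, j) \in t.
  by have : [set` t] (i, j) by rewrite -tE.
by rewrite !mem_cat; split; apply/orP; [left|right];
   apply/mapP; exists (i, j).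
Qed.

Definition mulfmx_fun (A B : fmx) : I -> I -> D :=
  fun i j => \sum_(k \in [set: I]) rmul (A i k) (B k j).

Lemma mulfmx_funE (A B : fmx) (s : seq I) i j : uniq s ->
  (forall k, (A i k != 0) && (B k j != 0) -> k \in s) ->
  mulfmx_fun A B i j = \sum_(k <- s) rmul (A i k) (B k j).
Proof.
move=> us sP; rewrite /mulfmx_fun (fsbigE s) //.
  by apply: eq_bigl => k; rewrite in_setT.
move=> k _ /negP ks.
have [->|A0] := eqVneq (A i k) 0; first exact: rmul0r.
have [->|B0] := eqVneq (B k j) 0; first exact: rmulr0.
by case: ks; apply: sP; rewrite A0 B0.
Qed.

Lemma mulfmx_subproof (A B : fmx) : mulfmx_fun A B \in fmx_pred.
Proof.
apply/asboolP.
have [[s sP] [t tP]] := (fmx_seqP A, fmx_seqP B).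
apply: (@sub_finite_set _ _ ([set` s] `*` [set` t])); last first.
  by apply: finite_setX; exact: finite_seq.
move=> [i j] /= nz; apply/not_notP => nst.
case/negP: nz; apply/eqP; rewrite /mulfmx_fun fsbig1 // => k _.
have [->|A0] := eqVneq (A i k) 0; first exact: rmul0r.
have [->|B0] := eqVneq (B k j) 0; first exact: rmulr0.
by case: nst; split=> /=; [case: (sP _ _ A0) | case: (tP _ _ B0)].
Qed.

Definition mulfmx (A B : fmx) : fmx := FMx (mulfmx_subproof A B).

Lemma mulfmxE (A B : fmx) (s : seq I) i j : uniq s ->
  (forall k, (A i k != 0) && (B k j != 0) -> k \in s) ->
  mulfmx A B i j = \sum_(k <- s) rmul (A i k) (B k j).
Proof. exact: mulfmx_funE. Qed.

Lemma fmxDE (A B : fmx) i j : (A + B) i j = A i j + B i j.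
Proof. by []. Qed.

Lemma mulfmxA : associative mulfmx.
Proof.
move=> A B C; apply: fmxP => i j.
have [[s0 sP0] [t0 tP0]] := (fmx_seqP A, fmx_seqP C).
pose s := undup s0; pose t := undup t0.
have sP x y : A x y != 0 -> y \in s by rewrite mem_undup => /sP0[].
have tP x y : C x y != 0 -> x \in t by rewrite mem_undup => /tP0[].
rewrite (mulfmxE (undup_uniq s0)); last by move=> k /andP[/sP].
rewrite (mulfmxE (undup_uniq t0)); last by move=> k /andP[_ /tP].
under eq_bigr => k _.
  rewrite (mulfmxE (undup_uniq t0)); last by move=> l /andP[_ /tP].
  rewrite rmul_sumr; over.
under [RHS]eq_bigr => k _.
  rewrite (mulfmxE (undup_uniq s0)); last by move=> l /andP[/sP].
  rewrite rmul_suml; over.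
rewrite exchange_big; apply: eq_bigr => k _; apply: eq_bigr => l _.
exact: rmulA.
Qed.

Lemma mulfmxDl : left_distributive mulfmx +%R.
Proof.
move=> A B C; apply: fmxP => i j; have [t tP] := fmx_seqP C.
have tP' (X : fmx) k : (X i k != 0) && (C k j != 0) -> k \in undup t.
  by rewrite mem_undup => /andP[_ /tP[]].
rewrite fmxDE !(mulfmxE (undup_uniq t)); [|exact: tP'..].
by rewrite -big_split; apply: eq_bigr => k _; rewrite fmxDE rmulDl.
Qed.

Lemma mulfmxDr : right_distributive mulfmx +%R.
Proof.
move=> A B C; apply: fmxP => i j; have [t tP] := fmx_seqP A.
have tP' (X : fmx) k : (A i k != 0) && (X k j != 0) -> k \in undup t.
  by rewrite mem_undup => /andP[/tP[]].
rewrite fmxDE !(mulfmxE (undup_uniq t)); [|exact: tP'..].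
by rewrite -big_split; apply: eq_bigr => k _; rewrite fmxDE rmulDr.
Qed.

HB.instance Definition _ :=
  Zmodule_isRng.Build fmx mulfmxA mulfmxDl mulfmxDr.

End FiniteMatrices.

Section MatrixGrading.
Context (G : groupoid) (D : rngType) (deg : G -> set D).

(* The component of degree g h k, read as {0} when g h k is undefined. *)
Definition deg3 (g h k : G) : set D :=
  [set x | (composable3 g h k -> deg (gcomp3 g h k) x) /\
           (~ composable3 g h k -> x = 0)].

(* The grading of the ring of finite matrices [fmx I D] attached to sigma. *)
Definition fmx_deg (I : choiceType) (sigma : I -> G) : G -> set (fmx I D) :=
  fun g => [set A | forall i j, deg3 (sigma i) g (ginv (sigma j)) (A i j)].

(* The grading of the ring of 1 x 1 matrices attached to the sequence (s). *)
Definition fmx1_deg (s : G) : G -> set (fmx unit D) :=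
  fmx_deg (fun _ : unit => s).

End MatrixGrading.

(* Main.v *)
Require Import Defs.
From HB Require Import structures.
From mathcomp Require Import all_boot all_order all_algebra.
From mathcomp Require Import boolp classical_sets functions cardinality fsbigop.

Set Implicit Arguments.
Unset Strict Implicit.
Unset Printing Implicit Defensive.

Import GRing.Theory.
Local Open Scope ring_scope.
Local Open Scope classical_set_scope.

(** Write R and S for the two matrix rings, s_i for sigma_i, and E_i for the
    diagonal matrix units, in R as well as in S.

    If the indices are matched by pi and tau, choose nonzero w_i in D with
    delta_(pi i) = tau deg(w_i) s_i.  Conjugating by the diagonal matrix of the
    w_i and applying the isomorphism D -> D' to all the entries is a graded
    isomorphism R -> S ([matrix_isom_of_translate]).

    Conversely, let f : R -> S be a graded isomorphism.  Its inverse preserves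
    degrees as well, because both matrix rings are direct sums of their
    components ([fmx_grading], [graded_inverse]), so the argument is symmetric
    in R and S.  Each E_i is a primitive idempotent of degree d(s_i), hence so
    is f(E_i), and a primitive homogeneous idempotent of S is equivalent, in its
    own degree, to some E_j ([primitive_equiv]).  Call i and j linked when f(E_i)
    and E_j are equivalent.  This relation is total on both sides and
    difunctional.  The i linked to a given j and the j' linked to a given i are
    finite in number by d-finiteness, and equally many when i and j are linked:
    orthogonal idempotents equivalent to E_j give a factorization of an identity
    matrix over a graded division ring, and Gaussian elimination bounds their
    number ([orthogonal_card_le], [left_kernel]).  Hence some bijection pi links
    each i to pi(i) ([linked_bijection]).

    Fix an index k, put l = pi(k) and tau = delta_l s_k^-1.  A link identifies
    the corners of R and S at its two indices, and links at i and k identify the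
    off-diagonal corners as well.  The corner at k gives D' = D with
    degrees conjugated by tau ([linked_corner_isom]), and the corner at (i, k),
    which is nonzero in degree delta_(pi i)^-1 delta_l, gives
    delta_(pi i) in tau supp(D) s_i ([linked_translate]). *)

(** * Products in a groupoid *)

Section GroupoidTheory.
Context (G : groupoid).
Implicit Types g h k s t a : G.

Lemma gcompKV g h : dom g = cod h -> gcomp (ginv g) (gcomp g h) = h.
Proof.
by move=> gh; rewrite gcompA ?dom_ginv // gcompVm gh gcomp1m.
Qed.

Lemma gcompKm g h : dom g = cod h -> gcomp (gcomp g h) (ginv h) = g.
Proof.
by move=> gh; rewrite -gcompA ?cod_ginv // gcompmV -gh gcompm1.
Qed.

Lemma ginvK : involutive (@ginv G).
Proof.
move=> g; have := gcompKV (dom_ginv g).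
by rewrite gcompVm -(cod_ginv g) -dom_ginv gcompm1.
Qed.

Lemma ginvM g h : dom g = cod h -> ginv (gcomp g h) = gcomp (ginv h) (ginv g).
Proof.
move=> gh; set k := gcomp g h.
have dk : dom k = dom h by rewrite dom_gcomp.
have ck : cod k = cod g by rewrite cod_gcomp.
have gk : gcomp (ginv g) k = h by rewrite gcompKV.
have hk : gcomp (gcomp (ginv h) (ginv g)) k = idm (dom k).
  by rewrite -gcompA ?dom_ginv ?cod_ginv // gk gcompVm dk.
have := congr1 (fun z => gcomp z (ginv k)) hk.
rewrite gcompKm; last by rewrite dom_gcomp ?dom_ginv ?cod_ginv.
by move=> ->; rewrite -cod_ginv gcomp1m.
Qed.

Lemma dom_gcomp3 g h k : composable3 g h k -> dom (gcomp3 g h k) = dom k.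
Proof. by case=> gh hk; rewrite /gcomp3 dom_gcomp ?dom_gcomp. Qed.

Lemma cod_gcomp3 g h k : composable3 g h k -> cod (gcomp3 g h k) = cod g.
Proof. by case=> gh hk; rewrite /gcomp3 !cod_gcomp ?dom_gcomp. Qed.

Lemma composable3V s g t :
  composable3 s g (ginv t) <-> cod g = dom s /\ dom g = dom t.
Proof. by rewrite /composable3 /composable cod_ginv; split=> -[]. Qed.

(** The map g |-> s g t is undone by s^-1 and t^-1.  This makes the degrees
    s_i g s_j^-1 of the entries of a matrix determine g, and lets every degree
    of D occur at every position (i, j). *)
Lemma gconjK s g t : composable3 s g t ->
  gcomp3 (ginv s) (gcomp3 s g t) (ginv t) = g.
Proof.
move=> [sg gt]; rewrite /gcomp3.
have sgt : dom (gcomp s g) = cod t by rewrite dom_gcomp.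
rewrite -(@gcompA _ (ginv s)) ?dom_ginv ?cod_ginv ?cod_gcomp ?dom_gcomp //.
by rewrite gcompKm // gcompKV.
Qed.

Lemma gconjVK s a t : cod a = cod s -> dom a = cod t ->
  gcomp3 s (gcomp3 (ginv s) a t) (ginv t) = a.
Proof.
by move=> sa at_; rewrite -{1}(ginvK s) gconjK //; split=> //; rewrite /composable dom_ginv.
Qed.

Lemma gcomp3_nest s a g b t : dom s = cod a -> composable3 a g b ->
  dom b = cod t ->
  gcomp3 s (gcomp3 a g b) t = gcomp3 (gcomp s a) g (gcomp b t).
Proof.
move=> sa [ag gb] bt; rewrite /gcomp3.
have ga : dom (gcomp a g) = cod b by rewrite dom_gcomp.
rewrite (@gcompA _ s _ b) ?cod_gcomp // (@gcompA _ s) //.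
by rewrite -gcompA // !dom_gcomp // ?cod_gcomp.
Qed.

Lemma gconj_comp s g k h t : composable3 s g (ginv k) ->
  composable3 k h (ginv t) ->
  gcomp (gcomp3 s g (ginv k)) (gcomp3 k h (ginv t))
  = gcomp3 s (gcomp g h) (ginv t).
Proof.
move=> [sg gk] [kh ht]; move: sg gk kh ht; rewrite /composable !cod_ginv /gcomp3.
move=> sg gk kh ht.
have gh : dom g = cod h by rewrite gk.
have -> : gcomp (gcomp k h) (ginv t) = gcomp k (gcomp h (ginv t)).
  by rewrite gcompA ?cod_ginv.
have sgk : dom (gcomp s g) = dom k by rewrite dom_gcomp.
rewrite gcompA; first last.
- by rewrite cod_gcomp // cod_ginv.
- by rewrite dom_gcomp ?dom_ginv ?cod_ginv.
rewrite -(@gcompA _ _ (ginv k)) ?dom_ginv ?cod_ginv // gcompVm.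
rewrite -[in idm _]sgk gcompm1 (@gcompA _ s) //.
by rewrite (@gcompA _ (gcomp s g)) ?dom_gcomp ?cod_ginv.
Qed.

End GroupoidTheory.

(** * Gradings by the morphisms of a groupoid *)

Section Gradings.
Context (G : groupoid).

(** The subgroup generated by the components of degree in T, as an
    intersection of subgroups: an additive map that preserves degrees carries
    it into its counterpart by instantiating P with a preimage, so no finite
    sums have to be manipulated. *)
Definition hom_span (V : zmodType) (deg : G -> set V) (T : set G) : set V :=
  [set x | forall P : set V, P 0 -> (forall a b, P a -> P b -> P (a - b)) ->
    (forall g a, T g -> deg g a -> P a) -> P x].

(** A direct sum decomposition, read one degree at a time: the component of
    degree g and the span of the other components are complements. *)
Record grading (V : zmodType) (deg : G -> set V) : Prop := Grading {
  grading0 : forall g, deg g 0;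
  gradingB : forall g a b, deg g a -> deg g b -> deg g (a - b);
  grading_split : forall g x, exists2 a,
    deg g a & hom_span deg [set h | h <> g] (x - a);
  grading_indep : forall g a,
    deg g a -> hom_span deg [set h | h <> g] a -> a = 0
}.

Section HomSpan.
Context (V : zmodType) (deg : G -> set V) (T : set G).

Lemma hom_span0 : hom_span deg T 0. Proof. by []. Qed.

Lemma hom_spanB a b :
  hom_span deg T a -> hom_span deg T b -> hom_span deg T (a - b).
Proof. by move=> Ta Tb P P0 PB PT; exact: (PB _ _ (Ta P P0 PB PT) (Tb P P0 PB PT)). Qed.

Lemma hom_span_deg g a : T g -> deg g a -> hom_span deg T a.
Proof. by move=> Tg ga P P0 PB PT; exact: PT ga. Qed.
End HomSpan.

Section GradingTheory.
Context (V : zmodType) (deg : G -> set V) (gV : grading deg).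

Lemma gradingN g a : deg g a -> deg g (- a).
Proof. by move=> ga; rewrite -sub0r; apply: gradingB => //; exact: grading0. Qed.

Lemma gradingD g a b : deg g a -> deg g b -> deg g (a + b).
Proof. by move=> ga /gradingN gb; rewrite -[b]opprK; exact: gradingB. Qed.

Lemma grading_sum g (J : eqType) (s : seq J) (F : J -> V) :
  (forall k, k \in s -> deg g (F k)) -> deg g (\sum_(k <- s) F k).
Proof.
move=> gF; rewrite big_seq; elim/big_ind: _ => //; first exact: grading0.
exact: gradingD.
Qed.

Lemma grading_ind (P : set V) : P 0 ->
  (forall a b, P a -> P b -> P (a - b)) -> (forall g a, deg g a -> P a) ->
  inhabited G -> forall x, P x.
Proof.
move=> P0 PB Pdeg [g] x; have [a ga xa] := grading_split gV g x.
have Pxa : P (x - a) by apply: (xa P) => // h b _; exact: Pdeg.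
by have := PB _ _ Pxa (Pdeg _ _ (gradingN ga)); rewrite opprK subrK.
Qed.
End GradingTheory.

(** Let b have degree g, and split f' b into a part a of degree g and a part in
    the span of the other degrees.  Under f the second part becomes b - f a,
    which has degree g and lies in the span of the other degrees, hence is 0. *)
Lemma graded_inverse (V W : zmodType) (degV : G -> set V) (degW : G -> set W)
    (f : {additive V -> W}) (f' : W -> V) :
  grading degV -> grading degW -> cancel f f' -> cancel f' f ->
  (forall g a, degV g a -> degW g (f a)) ->
  forall g b, degW g b -> degV g (f' b).
Proof.
move=> gV gW fK f'K fdeg g b gb.
have [a ga] := grading_split gV g (f' b).
have spanf x T : hom_span degV T x -> hom_span degW T (f x).
  move=> Tx; apply: (Tx (fun x => hom_span degW T (f x))).
  - by rewrite raddf0; exact: hom_span0.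
  - by move=> c d; rewrite raddfB; exact: hom_spanB.
  - by move=> h c Th hc; exact: (hom_span_deg Th (fdeg h c hc)).
move=> /spanf; rewrite raddfB f'K => span_ba.
have ba := gradingB gW gb (fdeg _ _ ga).
by rewrite (subr0_eq (grading_indep gW ba span_ba)) fK.
Qed.

(** The existence of the decomposition of x gives the splitting.  Its
    uniqueness gives independence: an element of degree g in the span of the
    other degrees has a decomposition concentrated at g and another one that
    vanishes at g. *)
Lemma graded_ring_grading (R : rngType) (deg : G -> set R) (one : obj G -> R) :
  graded_ring deg one -> grading deg.
Proof.
move=> gR; have d0 := deg_0 gR; have dB := deg_sub gR.
have fsE (c : G -> R) (s : seq G) : uniq s ->
    (forall g, c g != 0 -> g \in s) ->
    \sum_(g \in [set: G]) c g = \sum_(g <- s) c g.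
  move=> us sP; rewrite (fsbigE s) //; first by apply: eq_bigl => k; rewrite in_setT.
  by move=> g _; apply: contraNeq => /sP.
split=> // [g x|g a ga span_a].
  have [c [[fc cdeg xE] _]] := deg_direct_sum gR x.
  exists (c g) => //.
  have /finite_seqP[s0 sE] := fc; pose s := undup (g :: s0).
  have sP h : c h != 0 -> h \in s.
    move=> ch; rewrite mem_undup inE; apply/orP; right.
    by have : [set` s0] h by rewrite -sE.
  have us : uniq s by exact: undup_uniq.
  rewrite xE (fsE c s us sP) (bigD1_seq g) ?mem_undup ?mem_head //=.
  rewrite addrC addrK; elim/big_ind: _ => [|a b sa sb|h hg].
  - exact: hom_span0.
  - by rewrite -[b]opprK -[- b]sub0r; do 2?[apply: hom_spanB => //].
  - by apply: hom_span_deg (cdeg h); exact/eqP.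
(* The elements with a decomposition that vanishes at g form a subgroup. *)
pose P (x : R) := exists c : G -> R, [/\ finite_set [set h | c h != 0],
  forall h, deg h (c h), x = \sum_(h \in [set: G]) c h & c g = 0].
have P1 h x : deg h x -> exists c : G -> R, [/\ finite_set [set k | c k != 0],
    forall k, deg k (c k), x = \sum_(k \in [set: G]) c k &
    c = fun k => if k == h then x else 0].
  move=> hx; exists (fun k => if k == h then x else 0); split=> //.
  - apply: (sub_finite_set _ (finite_set1 h)) => k /=.
    by have [|] := eqVneq k h; rewrite ?eqxx.
  - by move=> k; have [->|] := eqVneq k h.
  - rewrite (fsE _ [:: h]) //; first by rewrite big_seq1 eqxx.
    by move=> k; rewrite inE; have [|] := eqVneq k h; rewrite ?eqxx.
have : P a.
  apply: span_a => [|x y [c [fc cdeg xE cg]] [d [fd ddeg yE dg]]|h x hg hx].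
  - exists (fun=> 0); split=> //; last by rewrite fsbig1.
    by apply: (@sub_finite_set _ _ set0) => // h /=; rewrite eqxx.
  - exists (fun h => c h - d h); split; last by rewrite cg dg subr0.
    + have fcd := finite_setU [set h | c h != 0] [set h | d h != 0].
      apply: (@sub_finite_set _ _ ([set h | c h != 0] `|` [set h | d h != 0])).
        move=> h /=; have [->|] := eqVneq (c h) 0; last by left.
        by rewrite sub0r oppr_eq0; right.
      by rewrite fcd.
    + by move=> h; exact: dB.
    + have /finite_seqP[s sE] := fc; have /finite_seqP[t tE] := fd.
      have inst h : (c h != 0) || (d h != 0) -> h \in undup (s ++ t).
        rewrite mem_undup mem_cat => /orP[ch|dh]; apply/orP; [left|right].
          by have : [set` s] h by rewrite -sE.
        by have : [set` t] h by rewrite -tE.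
      have us := undup_uniq (s ++ t).
      rewrite xE yE (fsE c _ us); last by move=> h ch; apply: inst; rewrite ch.
      rewrite (fsE d _ us); last by move=> h dh; apply: inst; rewrite dh orbT.
      rewrite (fsE _ _ us) ?sumrB // => h cdh; apply: inst.
      apply: contraR cdh; rewrite negb_or !negbK => /andP[/eqP-> /eqP->].
      by rewrite subr0.
  - have [c [fc cdeg xE cE]] := P1 h x hx; exists c; split=> //.
    by rewrite cE; case: eqP => // /esym.
move=> [c [fc cdeg xE cg]]; have [d [fd ddeg yE dE]] := P1 g a ga.
have [b [_ bU]] := deg_direct_sum gR a.
have cd : c = d by rewrite -(bU c) ?(bU d).
by move: cg; rewrite cd dE eqxx.
Qed.

End Gradings.

(** * Elementary matrices *)

Section ElementaryMatrices.
Context (I : choiceType) (D : rngType).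
Implicit Types (A B : fmx I D) (i j k l : I) (a b : D).

Lemma fmx0E i j : (0 : fmx I D) i j = 0. Proof. by []. Qed.

Lemma fmxBE A B i j : (A - B) i j = A i j - B i j. Proof. by []. Qed.

Lemma fmx_sumE (J : Type) (s : seq J) (F : J -> fmx I D) i j :
  (\sum_(k <- s) F k) i j = \sum_(k <- s) F k i j.
Proof. by apply: (big_morph (fun A : fmx I D => A i j)). Qed.

Definition emx_fun i j a : I -> I -> D :=
  fun k l => if (k == i) && (l == j) then a else 0.

Lemma emx_subproof i j a : emx_fun i j a \in @fmx_pred I D.
Proof.
apply/asboolP; apply: (sub_finite_set _ (finite_set1 (i, j))) => -[k l] /=.
by rewrite /emx_fun; case: andP => [[/eqP-> /eqP->]|]; rewrite ?eqxx.
Qed.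

Definition emx i j a : fmx I D := FMx (emx_subproof i j a).

Lemma emxE i j a k l :
  emx i j a k l = if (k == i) && (l == j) then a else 0.
Proof. by []. Qed.

Lemma emx_diag i j a : emx i j a i j = a.
Proof. by rewrite emxE !eqxx. Qed.

Lemma emx0 i j : emx i j 0 = 0.
Proof. by apply: fmxP => k l; rewrite emxE if_same. Qed.

Lemma emxB i j a b : emx i j (a - b) = emx i j a - emx i j b.
Proof.
by apply: fmxP => k l; rewrite fmxBE !emxE; case: ifP; rewrite ?subr0.
Qed.

Lemma emx_inj i j : injective (emx i j).
Proof. by move=> a b /(congr1 (fun A : fmx I D => A i j)); rewrite !emx_diag. Qed.

Lemma emx_mulE i j a A k l :
  rmul (emx i j a) A k l = if k == i then rmul a (A j l) else 0.
Proof.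
rewrite [LHS](@mulfmxE _ _ _ _ [:: j]) //; last first.
  by move=> h; rewrite emxE inE; case: (h == j) => //; rewrite andbF eqxx.
rewrite big_seq1 emxE eqxx andbT.
by case: ifP => // _; rewrite rmul0r.
Qed.

Lemma mul_emxE A i j a k l :
  rmul A (emx i j a) k l = if l == j then rmul (A k i) a else 0.
Proof.
rewrite [LHS](@mulfmxE _ _ _ _ [:: i]) //; last first.
  by move=> h; rewrite emxE inE; case: (h == i) => //; rewrite eqxx andbF.
rewrite big_seq1 emxE eqxx /=.
by case: ifP => // _; rewrite rmulr0.
Qed.

Lemma emx_mul_emx i j a A k l b :
  rmul (rmul (emx i j a) A) (emx k l b) = emx i l (rmul (rmul a (A j k)) b).
Proof.
apply: fmxP => m n; rewrite mul_emxE emx_mulE emxE.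
by case: (m == i); case: (n == l) => //; rewrite rmul0r.
Qed.

Lemma emxM i j a k b :
  rmul (emx i j a) (emx j k b) = emx i k (rmul a b).
Proof.
apply: fmxP => m n; rewrite emx_mulE !emxE eqxx /=.
by case: (m == i); case: (n == k) => //=; rewrite rmulr0.
Qed.

Lemma emxM0 i j a k l b : j != k -> rmul (emx i j a) (emx k l b) = 0.
Proof.
move=> jk; apply: fmxP => m n; rewrite emx_mulE !emxE (negbTE jk) /=.
by rewrite rmulr0 if_same.
Qed.

Lemma fmx_ind (P : set (fmx I D)) : P 0 ->
  (forall A B, P A -> P B -> P (A + B)) ->
  forall A, (forall i j, P (emx i j (A i j))) -> P A.
Proof.
move=> P0 PD A PA; have /finite_seqP[s0 sE] := fmx_finite A.
pose s := undup s0.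
have sP i j : A i j != 0 -> (i, j) \in s.
  by move=> nz; rewrite mem_undup; have : [set` s0] (i, j) by rewrite -sE.
suff -> : A = \sum_(p <- s) emx p.1 p.2 (A p.1 p.2).
  by elim/big_ind: _ => // p _; exact: PA.
apply: fmxP => i j; rewrite fmx_sumE.
have [Aij|/sP ijs] := eqVneq (A i j) 0.
  rewrite Aij big1 // => -[k l] _; rewrite emxE /=.
  by case: andP => // -[/eqP<- /eqP<-].
rewrite (bigD1_seq (i, j)) ?undup_uniq // emx_diag big1 => [|[k l]].
  by rewrite [RHS]addr0.
rewrite emxE /= xpair_eqE ![_ == i]eq_sym ![_ == j]eq_sym.
by move=> /negbTE->.
Qed.

End ElementaryMatrices.
Arguments emx_inj {I D}.

(** * Graded division rings and the grading of their matrices *)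

(** A graded division ring supported in e Gamma e.  All the identities 1_f
    with f <> e are then 0, and u = 1_e is an identity for the whole ring. *)
Record local_grdiv (G : groupoid) (D : rngType) (deg : G -> set D)
    (e : obj G) (u : D) : Prop := LocalGrdiv {
  grdiv_grading : grading deg;
  grdiv_mul : forall g h a b, composable g h ->
    deg g a -> deg h b -> deg (gcomp g h) (rmul a b);
  grdiv_supp : forall g a, deg g a -> a != 0 -> cod g = e /\ dom g = e;
  grdiv_one : deg (idm e) u;
  grdiv_mul1l : forall a, rmul u a = a;
  grdiv_mul1r : forall a, rmul a u = a;
  grdiv_one_neq0 : u != 0;
  grdiv_inv : forall g a, deg g a -> a != 0 ->
    exists b, [/\ deg (ginv g) b, rmul a b = u & rmul b a = u]
}.

Lemma rmulNr (D : rngType) (a b : D) : rmul a (- b) = - rmul a b.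
Proof. by apply/eqP; rewrite -addr_eq0 -rmulDr addNr rmulr0. Qed.

Lemma rmulNl (D : rngType) (a b : D) : rmul (- a) b = - rmul a b.
Proof. by apply/eqP; rewrite -addr_eq0 -rmulDl addNr rmul0r. Qed.

Lemma rmulBr (D : rngType) (a b c : D) : rmul a (b - c) = rmul a b - rmul a c.
Proof. by rewrite rmulDr rmulNr. Qed.

Lemma rmulBl (D : rngType) (a b c : D) : rmul (b - c) a = rmul b a - rmul c a.
Proof. by rewrite rmulDl rmulNl. Qed.

Lemma graded_division_ringP (G : groupoid) (D : rngType) (deg : G -> set D)
    (e : obj G) : graded_division_ring deg -> supp deg `<=` homset e e ->
  exists u, local_grdiv deg e u.
Proof.
move=> [one [gD [x x0] inv]] suppD; exists (one e).
have grD := graded_ring_grading gD.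
have sD g a : deg g a -> a != 0 -> cod g = e /\ dom g = e.
  by move=> ga a0; apply: suppD; exists a.
have Gi : inhabited G by exists; exact: (idm e).
have mul1l a : rmul (one e) a = a.
  move: a; apply: (grading_ind grD) => // [|a b Ha Hb|g a ga].
    exact: rmulr0.
    by rewrite rmulBr Ha Hb.
  have [->|/(sD _ _ ga)[<- _]] := eqVneq a 0; first exact: rmulr0.
  exact: (mul_one_l gD).
have mul1r a : rmul a (one e) = a.
  move: a; apply: (grading_ind grD) => // [|a b Ha Hb|g a ga].
    exact: rmul0r.
    by rewrite rmulBl Ha Hb.
  have [->|/(sD _ _ ga)[_ <-]] := eqVneq a 0; first exact: rmul0r.
  exact: (mul_one_r gD).
split=> //.
- exact: (deg_mul gD).
- exact: (deg_one gD).
- by apply: contra_neq x0 => one0; rewrite -[x]mul1l one0 rmul0r.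
- move=> g a ga a0; have [b [gb ab ba]] := inv g a ga a0.
  by have [cg dg] := sD g a ga a0; exists b; rewrite ab ba cg dg.
Qed.

Section MatrixGradingTheory.
Context (G : groupoid) (D : rngType) (deg : G -> set D) (e : obj G) (u : D).
Context (lD : local_grdiv deg e u).
Context (I : choiceType) (sigma : I -> G) (cod_sigma : forall i, cod (sigma i) = e).
Implicit Types (A B : fmx I D) (i j k : I).

Local Notation gr := (fmx_deg deg sigma).
Let gD := grdiv_grading lD.

Lemma deg3P (s g t : G) a : a != 0 -> deg3 deg s g (ginv t) a ->
  [/\ dom s = cod g, dom g = dom t & deg (gcomp3 s g (ginv t)) a].
Proof.
move=> a0 [degN deg0]; have cs : composable3 s g (ginv t).
  by apply/not_notP => /deg0 /eqP; apply/negP.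
by have [/esym ? ?] := (composable3V s g t).1 cs; split=> //; exact: degN.
Qed.

Lemma deg3I (s g t : G) a : (a != 0 ->
  [/\ dom s = cod g, dom g = dom t & deg (gcomp3 s g (ginv t)) a]) ->
  deg3 deg s g (ginv t) a.
Proof.
have [->|a0] := eqVneq a 0; first by move=> _; split=> // _; exact: grading0.
move=> /(_ isT)[sg gt ga]; split=> // -[]; split=> //.
by rewrite /composable cod_ginv.
Qed.

Lemma fmx_degP g A : gr g A <-> forall i j, A i j != 0 ->
  [/\ dom (sigma i) = cod g, dom g = dom (sigma j) &
      deg (gcomp3 (sigma i) g (ginv (sigma j))) (A i j)].
Proof.
split=> [gA i j A0|gA i j]; first exact: deg3P (gA i j).
by apply: deg3I; exact: gA.
Qed.

Lemma fmx_deg_entry g A i j : gr g A -> dom (sigma i) = cod g ->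
  dom g = dom (sigma j) -> deg (gcomp3 (sigma i) g (ginv (sigma j))) (A i j).
Proof. by move=> /(_ i j)[degN _] sg gt; apply/degN/composable3V. Qed.

(** Degree idm f is where the idempotents live: such a matrix is supported on
    the rows and columns whose sigma has domain f, of which a d-finite sequence
    has only finitely many. *)
Lemma fmx_deg_idm f A i j : gr (idm f) A -> A i j != 0 ->
  [/\ dom (sigma i) = f, dom (sigma j) = f &
      deg (gcomp (sigma i) (ginv (sigma j))) (A i j)].
Proof.
move=> /fmx_degP fA /fA; rewrite dom_idm cod_idm => -[si sj].
by rewrite /gcomp3 -{1}si gcompm1.
Qed.

Lemma emx_deg i j a g : cod g = e -> dom g = e -> deg g a ->
  gr (gcomp3 (ginv (sigma i)) g (sigma j)) (emx i j a).
Proof.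
move=> cg dg ga; apply/fmx_degP => k l; rewrite emxE.
case: andP => [[/eqP-> /eqP->]|]; rewrite ?eqxx // => _.
have cs : composable3 (ginv (sigma i)) g (sigma j).
  by rewrite /composable3 /composable dom_ginv !cod_sigma.
rewrite cod_gcomp3 // dom_gcomp3 // cod_ginv; split=> //.
by rewrite gconjVK // cod_sigma.
Qed.

Lemma emx_deg_idm i j a f : dom (sigma i) = f -> dom (sigma j) = f ->
  deg (gcomp (sigma i) (ginv (sigma j))) a -> gr (idm f) (emx i j a).
Proof.
move=> si sj ga; apply/fmx_degP => k l; rewrite emxE.
case: andP => [[/eqP-> /eqP->]|]; rewrite ?eqxx // => _.
by rewrite cod_idm dom_idm; split=> //; rewrite /gcomp3 -{1}si gcompm1.
Qed.

Lemma emx1_deg i : gr (idm (dom (sigma i))) (emx i i u).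
Proof. by apply: emx_deg_idm => //; rewrite gcompmV cod_sigma; exact: grdiv_one. Qed.

Lemma fmx_deg_mul g h A B : composable g h -> gr g A -> gr h B ->
  gr (gcomp g h) (rmul A B).
Proof.
move=> gh gA hB; have [s0 sP] := fmx_seqP A; pose s := undup s0.
have ABE i j : rmul A B i j = \sum_(k <- s) rmul (A i k) (B k j).
  apply: mulfmxE; first exact: undup_uniq.
  by move=> k /andP[/sP[_ ?] _]; rewrite mem_undup.
have term i j k : rmul (A i k) (B k j) != 0 ->
    [/\ dom (sigma i) = cod g, dom h = dom (sigma j) &
      deg (gcomp3 (sigma i) (gcomp g h) (ginv (sigma j))) (rmul (A i k) (B k j))].
  move=> nz; have A0 : A i k != 0 by apply: contra_neq nz => ->; rewrite rmul0r.
  have B0 : B k j != 0 by apply: contra_neq nz => ->; rewrite rmulr0.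
  have [si sk dA] := (fmx_degP g A).1 gA i k A0.
  have [tk tj dB] := (fmx_degP h B).1 hB k j B0.
  have cA : composable3 (sigma i) g (ginv (sigma k)) by apply/composable3V.
  have cB : composable3 (sigma k) h (ginv (sigma j)) by apply/composable3V.
  split=> //; rewrite -(gconj_comp cA cB); apply: (grdiv_mul lD) => //.
  by rewrite /composable dom_gcomp3 // cod_gcomp3 // dom_ginv.
apply/fmx_degP => i j nz; rewrite cod_gcomp // dom_gcomp //.
have [k kE] : exists k, rmul (A i k) (B k j) != 0.
  apply/not_existsP => all0; case/eqP: nz; rewrite ABE big1 // => k _.
  by apply/eqP/negP=> /negP; exact: all0.
have [si sj _] := term _ _ _ kE; split=> //; rewrite ABE.
apply: grading_sum => // l _; have [->|/term[]] := eqVneq (rmul (A i l) (B l j)) 0 => //.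
exact: grading0.
Qed.

Lemma fmx_deg_mul_idm f A B : gr (idm f) A -> gr (idm f) B ->
  gr (idm f) (rmul A B).
Proof.
move=> fA fB; have := @fmx_deg_mul (idm f) (idm f) A B.
rewrite /composable dom_idm cod_idm => /(_ erefl fA fB).
by rewrite -{1}(cod_idm f) gcomp1m.
Qed.

(** Splitting is additive, so it may be checked on the matrices with a single
    entry, where the splitting of that entry in D with respect to
    s_i g s_j^-1 is carried over by a |-> emx i j a.  Independence is checked
    entry by entry, since distinct degrees of a matrix put an entry in distinct
    components of D. *)
Lemma fmx_grading : grading gr.
Proof.
have gr0 g : gr g 0 by apply/fmx_degP => i j; rewrite fmx0E eqxx.
have grB g A B : gr g A -> gr g B -> gr g (A - B).
  move=> gA gB i j; rewrite fmxBE.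
  have [A1 A0] := gA i j; have [B1 B0] := gB i j.
  split=> c; first by apply: gradingB; [exact: gD|exact: A1|exact: B1].
  by rewrite A0 // B0 // subr0.
split=> // [g A|g A gA spanA].
- apply: (fmx_ind (P := fun A => exists2 a, gr g a & hom_span gr [set h | h <> g] (A - a)))
    => [|A' B [A1 gA1 sA] [B1 gB1 sB]|i j].
  + by exists 0 => //; rewrite subr0; exact: hom_span0.
  + exists (A1 - - B1); first by apply: (grB) => //; rewrite -[- B1]sub0r; exact: grB.
    rewrite [X in hom_span _ _ X](_ : _ = (A' - A1) - (0 - (B - B1))).
      by apply: hom_spanB => //; apply: hom_spanB => //; exact: hom_span0.
    by rewrite !opprK sub0r opprK opprD addrACA.
  + move: (A i j) => a.
    have spanE (T : set G) b : hom_span deg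
        [set al | cod al = e -> dom al = e ->
           T (gcomp3 (ginv (sigma i)) al (sigma j))] b -> hom_span gr T (emx i j b).
      move=> /(_ (fun b => hom_span gr T (emx i j b))); apply.
      * by rewrite emx0; exact: hom_span0.
      * by move=> c d; rewrite emxB; exact: hom_spanB.
      * move=> al c Tal alc; have [->|c0] := eqVneq c 0.
          by rewrite emx0; exact: hom_span0.
        have [cal dal] := grdiv_supp lD alc c0.
        by apply: hom_span_deg (emx_deg i j cal dal alc); exact: Tal.
    (* If s_i g s_j^-1 is undefined, the whole entry lies off degree g. *)
    have [gs|ngs] := pselect (composable3 (sigma i) g (ginv (sigma j))).
    * have [b gb ab] := grading_split gD (gcomp3 (sigma i) g (ginv (sigma j))) a.
      have [cg dg] := (composable3V _ _ _).1 gs.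
      exists (emx i j b).
        apply/fmx_degP => k l; rewrite emxE.
        by case: andP => [[/eqP-> /eqP->]|]; rewrite ?eqxx // => _.
      rewrite -emxB; apply: spanE; apply: (ab (hom_span _ _)).
      - exact: hom_span0.
      - exact: hom_spanB.
      - move=> al c /= ne alc; apply: hom_span_deg alc => /= cal dal.
        apply: contra_not ne => <-.
        by rewrite gconjVK // cod_sigma.
    * exists 0 => //; rewrite subr0; apply: spanE.
      move: a; apply: (grading_ind gD) => [|b c|al b alb|]; [exact: hom_span0|exact: hom_spanB| |].
        2: exact: (inhabits g).
      apply: hom_span_deg alb => /= cal dal; apply: contra_not ngs => <-.
      have cs : composable3 (ginv (sigma i)) al (sigma j).
        by rewrite /composable3 /composable dom_ginv !cod_sigma.
      by apply/composable3V; rewrite cod_gcomp3 // dom_gcomp3 // cod_ginv.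
- apply: fmxP => i j; rewrite fmx0E; apply/eqP/negPn/negP => nz.
  have [si sj dA] := (fmx_degP g A).1 gA i j nz.
  case/eqP: nz; apply: (grading_indep gD dA).
  apply: (spanA (fun A => hom_span deg _ (A i j))) => [|B C|h B hg hB].
  + exact: hom_span0.
  + exact: hom_spanB.
  + have [->|nz] := eqVneq (B i j) 0; first exact: hom_span0.
    have [ti tj dB] := (fmx_degP h B).1 hB i j nz.
    apply: hom_span_deg dB => /= E; apply: hg.
    have ch : composable3 (sigma i) h (ginv (sigma j)) by apply/composable3V.
    have cg : composable3 (sigma i) g (ginv (sigma j)) by apply/composable3V.
    by rewrite -(gconjK ch) -[RHS](gconjK cg) E.
Qed.

End MatrixGradingTheory.

(** * Equivalent idempotents *)

(** Murray-von Neumann equivalence inside C.  For idempotents p and q of R it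
    says that R p and R q are isomorphic; here C is a component of degree
    idm f, so the isomorphism preserves degrees. *)
Definition idem_equiv (R : rngType) (C : set R) (p q : R) : Prop :=
  exists x y, [/\ C x, C y, rmul x y = p & rmul y x = q].

Section IdemEquiv.
Context (R : rngType) (C : set R).
Context (CM : forall a b, C a -> C b -> C (rmul a b)).
Implicit Types p q r : R.

Lemma idem_equiv_sym p q : idem_equiv C p q -> idem_equiv C q p.
Proof. by move=> [x [y [Cx Cy xy yx]]]; exists y, x. Qed.

Lemma idem_equiv_trans p q r : rmul p p = p -> rmul r r = r ->
  idem_equiv C p q -> idem_equiv C q r -> idem_equiv C p r.
Proof.
move=> pp rr [x [y [Cx Cy xy yx]]] [z [t [Cz Ct zt tz]]].
exists (rmul x z), (rmul t y); split; [exact: CM|exact: CM| |].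
- by rewrite rmulA -(rmulA x) zt -yx rmulA xy -rmulA xy.
- by rewrite rmulA -(rmulA t) yx -zt rmulA tz -rmulA tz.
Qed.
End IdemEquiv.

(** Minimality among the nonzero idempotents of C.  Unlike a description by
    matrices it depends only on the ring and on C, so graded isomorphisms
    preserve it. *)
Definition primitive_in (R : rngType) (C : set R) (p : R) : Prop :=
  [/\ C p, p != 0, rmul p p = p & forall q, C q ->
     rmul q q = q -> rmul p q = q -> rmul q p = q -> q != 0 -> q = p].

(** * Linear dependence over a graded division ring *)

Section LeftKernel.
Context (T : rngType) (K : set T) (one : T) (J : eqType) (P : J -> set T).
Context (K0 : K 0) (KB : forall a b, K a -> K b -> K (a - b)).
Context (KM : forall a b, K a -> K b -> K (rmul a b)).
Context (K1 : K one) (one_neq0 : one != 0).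
Context (PB : forall j a b, P j a -> P j b -> P j (a - b)).
Context (KP : forall j a b, K a -> P j b -> P j (rmul a b)).
Context (Pdiv : forall j a, P j a -> a != 0 -> exists b,
  forall c, P j c -> K (rmul c b) /\ rmul (rmul c b) a = c).

(** More rows than columns force a left dependence: this is Gaussian
    elimination, which needs no commutativity.  The column j has its entries in
    a group P j, on which the scalars K act from the left and in which
    quotients of entries lie in K; in the application P j is a homogeneous
    component of a graded division ring, which need not be closed under
    products. *)
Lemma left_kernel (t : seq J) (I : eqType) (s : seq I) (Y : I -> J -> T) :
  uniq s -> (size t < size s)%N ->
  (forall i j, i \in s -> j \in t -> P j (Y i j)) ->
  exists v : I -> T, [/\ forall i, i \in s -> K (v i),
    exists2 i, i \in s & v i != 0 &
    forall j, j \in t -> \sum_(i <- s) rmul (v i) (Y i j) = 0].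
Proof.
elim: t s Y => [|j t IH] s Y us lt_ts PY.
  case: s us lt_ts PY => // i s us _ _; exists (fun=> one); split=> //.
  by exists i; rewrite ?mem_head.
have [Y0|] := pselect (forall i, i \in s -> Y i j = 0).
  have [i k si tk|v [Kv v0 vY]] := IH s Y us (ltnW lt_ts).
    by apply: PY => //; rewrite inE tk orbT.
  exists v; split=> // k; rewrite inE => /orP[/eqP->|/vY//].
  by rewrite big_seq big1 // => i /Y0 ->; rewrite rmulr0.
move=> /existsNP[p /not_implyP[sp /eqP Yp0]].
have [b bP] := Pdiv (PY p j sp (mem_head _ _)) Yp0.
(* The pivot is Y p j, with b as its inverse; Y' has column j cleared. *)
pose c i := rmul (Y i j) b; pose Y' i k := Y i k - rmul (c i) (Y p k).
have Kc i : i \in s -> K (c i) by move=> si; exact: (bP _ (PY i j si (mem_head _ _))).1.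
pose s' := rem p s.
have s's i : i \in s' -> i \in s by exact: mem_rem.
have [| |i k si tk|v [Kv v0 vY]] := IH s' Y'; first exact: rem_uniq.
- by rewrite size_rem // -ltnS prednK // (leq_ltn_trans _ lt_ts).
- apply: PB; first by apply: PY; [exact: s's | rewrite inE tk orbT].
  by apply: KP; [apply: Kc; exact: s's | apply: PY => //; rewrite inE tk orbT].
pose w i := if i == p then - \sum_(k <- s') rmul (v k) (c k) else v i.
have pNs' : p \notin s' by rewrite mem_rem_uniqF.
have wE i : i \in s' -> w i = v i.
  by rewrite /w; case: eqP => // -> ps'; rewrite ps' in pNs'.
have Ksum : K (\sum_(k <- s') rmul (v k) (c k)).
  rewrite big_seq; elim/big_ind: _ => // [x y Kx Ky|i si].
    by rewrite -[y]opprK -[- y]sub0r; do 2?apply: KB.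
  by apply: KM; [exact: Kv | apply: Kc; exact: s's].
exists w; split.
- move=> i si; rewrite /w; case: eqP => [_|/eqP ip]; first by rewrite -sub0r; exact: KB.
  by apply: Kv; rewrite mem_rem_uniq // inE ip.
- by have [i si vi] := v0; exists i; [exact: s's | rewrite wE].
move=> k jtk; rewrite (perm_big _ (perm_to_rem sp)) big_cons /=.
have -> : \sum_(i <- s') rmul (w i) (Y i k)
    = \sum_(i <- s') rmul (v i) (Y' i k) +
      rmul (\sum_(i <- s') rmul (v i) (c i)) (Y p k).
  rewrite rmul_suml -big_split /= !big_seq; apply: eq_bigr => i /wE->.
  by rewrite /Y' rmulBr rmulA subrK.
rewrite /w eqxx rmulNl addrCA addNr addr0.
move: jtk; rewrite inE => /orP[/eqP->|/vY//].
rewrite big_seq big1 // => i /s's si.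
by rewrite /Y' (bP _ (PY i j si (mem_head _ _))).2 subrr rmulr0.
Qed.

End LeftKernel.

(** * Primitive homogeneous idempotents of a matrix ring *)

Section Corners.
Context (G : groupoid) (D : rngType) (deg : G -> set D) (e : obj G) (u : D).
Context (lD : local_grdiv deg e u).
Context (I : choiceType) (sigma : I -> G) (cod_sigma : forall i, cod (sigma i) = e).
Local Notation gr := (fmx_deg deg sigma).
Local Notation E i := (emx i i u).
Implicit Types (i j : I) (A p q x y z : fmx I D).

Lemma emx1_idem i : rmul (E i) (E i) = E i.
Proof. by rewrite emxM (grdiv_mul1l lD). Qed.

Lemma emx1_corner i A j : rmul (rmul (E i) A) (E j) = emx i j (A i j).
Proof. by rewrite emx_mul_emx (grdiv_mul1l lD) (grdiv_mul1r lD). Qed.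

Lemma emx1_neq0 i : E i != 0.
Proof. by rewrite -(emx0 D i i) (inj_eq (@emx_inj _ _ i i)); exact: grdiv_one_neq0 lD. Qed.

Lemma grdiv_idem g a : deg g a -> rmul a a = a -> a != 0 -> a = u.
Proof.
move=> ga aa a0; have [b [_ ab ba]] := grdiv_inv lD ga a0.
by rewrite -ba -{2}aa rmulA ba (grdiv_mul1l lD).
Qed.

(** An idempotent q of degree idm f with E_i q = q = q E_i has a single entry,
    which is a homogeneous idempotent of D, hence 0 or 1. *)
Lemma emx1_primitive i : primitive_in (gr (idm (dom (sigma i)))) (E i).
Proof.
split; [exact: (emx1_deg lD)|exact: emx1_neq0|exact: emx1_idem|].
move=> q fq qq Eq qE q0.
have qE' : q = emx i i (q i i) by rewrite -emx1_corner Eq qE.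
have qii0 : q i i != 0 by apply: contra_neq q0 => qii; rewrite qE' qii emx0.
have [_ _ dq] := fmx_deg_idm lD fq qii0.
rewrite qE'; congr (emx i i _); apply: grdiv_idem dq _ qii0.
by move: qq; rewrite {1 2}qE' emxM => /(congr1 (fun A : fmx I D => A i i)); rewrite emx_diag.
Qed.

(** Every primitive homogeneous idempotent is equivalent to a diagonal unit.
    A nonzero entry p_kj gives x = p E_j and y = p_kj^-1 E_jk p with y x = E_j;
    then x y is a nonzero idempotent below p, so it is p. *)
Lemma primitive_equiv f p : primitive_in (gr (idm f)) p ->
  exists2 j, dom (sigma j) = f & idem_equiv (gr (idm f)) p (E j).
Proof.
move=> [fp p0 pp pmin].
have [k [j pkj]] : exists k j, p k j != 0.
  apply: contrapT => pN; case/eqP: p0; apply: fmxP => k j.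
  by apply: contrapT => /eqP pkj; apply: pN; exists k, j.
have [sk sj dp] := fmx_deg_idm lD fp pkj.
have [z [dz _ zp]] := grdiv_inv lD dp pkj.
have fE : gr (idm f) (E j) by rewrite -sj; exact: (emx1_deg lD).
have fEz : gr (idm f) (emx j k z).
  apply: (emx_deg_idm lD) => //; move: dz; by rewrite ginvM ?ginvK // cod_ginv sj sk.
pose x := rmul p (E j); pose y := rmul (emx j k z) p.
have fM := fmx_deg_mul_idm lD.
have fx : gr (idm f) x by exact: fM.
have fy : gr (idm f) y by exact: fM.
have yx : rmul y x = E j.
  by rewrite /y /x rmulA -(rmulA (emx j k z)) pp emx_mul_emx zp (grdiv_mul1l lD).
exists j => //; exists x, y; split=> //.
have px : rmul p x = x by rewrite /x rmulA pp.
have yp : rmul y p = y by rewrite /y -rmulA pp.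
have xyx : rmul x (E j) = x by rewrite /x -rmulA emx1_idem.
apply: pmin.
- exact: fM.
- by rewrite rmulA -(rmulA x) yx xyx.
- by rewrite rmulA px.
- by rewrite -rmulA yp.
- apply: contra_neq (emx1_neq0 j) => xy0.
  by rewrite -yx -xyx -yx (rmulA x) xy0 rmul0r rmulr0.
Qed.

(** At most as many orthogonal idempotents p_i are equivalent to E_j as there
    are diagonal units equivalent to E_j.  With x_i y_i = p_i and
    y_i x_i = E_j, orthogonality gives y_i x_k = 0 for i <> k, so row j of the
    y_i and column j of the x_k are rectangular matrices with product the
    identity, of inner size at most |t|.  If |t| < |s|, the rows of
    the first one would be dependent. *)
Lemma orthogonal_card_le (K : eqType) (s : seq K) (t : seq I) (p : K -> fmx I D) f j :
  uniq s -> uniq t ->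
  dom (sigma j) = f ->
  (forall i k : K, i \in s -> k \in s -> i != k -> rmul (p i) (p k) = 0) ->
  (forall i : K, i \in s -> rmul (p i) (p i) = p i) ->
  (forall i : K, i \in s -> idem_equiv (gr (idm f)) (p i) (E j)) ->
  (forall k, dom (sigma k) = f -> idem_equiv (gr (idm f)) (E j) (E k) -> k \in t) ->
  (size s <= size t)%N.
Proof.
move=> us ut sj p_orth p_idem p_eq tP; rewrite leqNgt; apply/negP => lt_ts.
have xyP (i : K) : exists xy : fmx I D * fmx I D, i \in s ->
    [/\ gr (idm f) xy.1, gr (idm f) xy.2, rmul xy.1 xy.2 = p i & rmul xy.2 xy.1 = E j].
  have [si|] := boolP (i \in s); last by exists (0, 0).
  by have [x [y xyE]] := p_eq i si; exists (x, y).
have [xy {}xyP] := choice xyP.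
pose x (i : K) := (xy i).1; pose y (i : K) := (xy i).2.
have fx (i : K) : i \in s -> gr (idm f) (x i) by move=> /xyP[].
have fy (i : K) : i \in s -> gr (idm f) (y i) by move=> /xyP[].
have xyE (i : K) : i \in s -> rmul (x i) (y i) = p i by move=> /xyP[].
have yxE (i : K) : i \in s -> rmul (y i) (x i) = E j by move=> /xyP[].
have yx (i k : K) : i \in s -> k \in s ->
    rmul (y i) (x k) j j = if i == k then u else 0.
  move=> si sk; have [->|ik] := eqVneq i k; first by rewrite yxE // emx_diag.
  pose m := rmul (y i) (x k).
  have -> : rmul (y i) (x k) j j = rmul (rmul (E j) m) (E j) j j.
    by rewrite emx1_corner emx_diag.
  suff -> : rmul (rmul (E j) m) (E j) = 0 by rewrite fmx0E.
  rewrite /m -{1}(yxE i si) -(yxE k sk) !rmulA -(rmulA (y i)) xyE //.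
  by rewrite -(rmulA _ (x k)) xyE // -(rmulA (y i)) p_orth // rmulr0 rmul0r.
have t_supp (i : K) k : i \in s -> y i j k != 0 -> k \in t.
  move=> si yik; have [_ sk dy] := fmx_deg_idm lD (fy i si) yik.
  apply: tP => //; have [z [dz yz zy]] := grdiv_inv lD dy yik.
  exists (emx j k (y i j k)), (emx k j z); split.
  - exact: (emx_deg_idm lD).
  - apply: (emx_deg_idm lD) => //; move: dz.
    by rewrite ginvM ?ginvK // cod_ginv sj sk.
  - by rewrite emxM yz.
  - by rewrite emxM zy.
(* The set {0} is needed for columns k with s_j s_k^-1 undefined. *)
pose P k := [set a | dom (sigma k) = f /\ deg (gcomp (sigma j) (ginv (sigma k))) a \/ a = 0].
have gD := grdiv_grading lD.
have [v [Kv [i0 si0 vi0] vY]] : exists v : K -> D,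
    [/\ forall i : K, i \in s -> deg (idm e) (v i),
    exists2 i : K, i \in s & v i != 0 &
    forall k, k \in t -> \sum_(i <- s) rmul (v i) (y i j k) = 0].
  apply: (@left_kernel _ (deg (idm e)) u _ P) => //.
  - exact: grading0.
  - exact: gradingB.
  - move=> a b da db; have := grdiv_mul lD _ da db.
    by rewrite -{3}(cod_idm e) gcomp1m; apply; rewrite /composable dom_idm cod_idm.
  - exact: grdiv_one lD.
  - exact: grdiv_one_neq0 lD.
  - move=> k a b [[sk da]|->] [[sk' db]|->].
    + by left; split=> //; exact: gradingB.
    + by rewrite subr0; left.
    + by rewrite sub0r; left; split=> //; exact: gradingN.
    + by rewrite subr0; right.
  - move=> k a b da [[sk db]|->]; last by right; rewrite rmulr0.
    left; split=> //; have := grdiv_mul lD _ da db.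
    rewrite -(cod_sigma j) -(@cod_gcomp _ (sigma j) (ginv (sigma k))) ?gcomp1m; last first.
      by rewrite cod_ginv sj sk.
    by apply; rewrite /composable dom_idm.
  - move=> k a [[sk da]|->]; last by rewrite eqxx.
    move=> a0; have [b [db ab ba]] := grdiv_inv lD da a0.
    exists b => c Pc; split; last by rewrite -rmulA ba (grdiv_mul1r lD).
    case: Pc => [[_ dc]|->]; last by rewrite rmul0r; exact: grading0.
    have cjk : composable (gcomp (sigma j) (ginv (sigma k)))
        (ginv (gcomp (sigma j) (ginv (sigma k)))).
      by rewrite /composable cod_ginv.
    have := grdiv_mul lD cjk dc db.
    by rewrite gcompmV cod_gcomp ?cod_sigma // cod_ginv sj sk.
  - move=> i k si tk; have [->|yik] := eqVneq (y i j k) 0; first by right.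
    by have [_ sk dy] := fmx_deg_idm lD (fy i si) yik; left.
case/eqP: vi0; rewrite -[v i0](grdiv_mul1r lD).
have yxt (i k : K) : i \in s -> k \in s ->
    rmul (y i) (x k) j j = \sum_(l <- t) rmul (y i j l) (x k l j).
  by move=> si sk; apply: mulfmxE => // l /andP[/t_supp->].
have -> : rmul (v i0) u = \sum_(i <- s) rmul (v i) (rmul (y i) (x i0) j j).
  rewrite (bigD1_seq i0) // yx // eqxx big_seq_cond big1 => [|i].
    by rewrite [RHS]addr0.
  by move=> /andP[si /negbTE ii0]; rewrite yx // ii0 rmulr0.
rewrite big_seq; under eq_bigr => i si do rewrite yxt // rmul_sumr.
rewrite exchange_big /= big_seq big1 // => l tl.
transitivity (rmul (\sum_(i <- s) rmul (v i) (y i j l)) (x i0 l j)).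
  by rewrite rmul_suml [RHS]big_seq; apply: eq_bigr => i _; rewrite rmulA.
by rewrite vY // rmul0r.
Qed.

End Corners.

(** * From an isomorphism to a matching of indices *)

(** A difunctional relation is a union of blocks A x B, for disjoint sets A and
    disjoint sets B; a bijection inside it exists when it is total on both
    sides and the two sides of each block have the same finite size. *)
Lemma difunctional_bijection (I I' : choiceType) (L : I -> I' -> Prop) :
  inhabited I -> inhabited I' ->
  (forall i j i' j', L i j -> L i' j -> L i' j' -> L i j') ->
  (forall i, exists j, L i j) -> (forall j, exists i, L i j) ->
  (forall i j, L i j -> exists (s : seq I) (t : seq I'),
     [/\ uniq s, uniq t, size s = size t,
         forall i', i' \in s <-> L i' j & forall j', j' \in t <-> L i j']) ->
  exists pi : I -> I', bijective pi /\ forall i, L i (pi i).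
Proof.
move=> [i0] [j0] difun Lr Ll Lcard.
(* The block of an index, named by its part in I'. *)
pose c i := [set j | L i j]; pose c' j := [set j' | exists i, L i j /\ L i j'].
have LE i j : L i j <-> c i = c' j.
  split=> [Lij|cE]; last first.
    have [i' L'] := Ll j; have : c' j j by exists i'.
    by rewrite -cE.
  apply/seteqP; split=> j'; first by move=> Lij'; exists i.
  by move=> [i' [Li'j Li'j']]; exact: difun Lij Li'j Li'j'.
have fib k : exists st : seq I * seq I', [/\ uniq st.1, uniq st.2,
    size st.1 = size st.2, forall i, i \in st.1 <-> c i = k &
    forall j, j \in st.2 <-> c' j = k].
  have [[i ik]|noi] := pselect (exists i, c i = k).
    have [j Lij] := Lr i; have [s [t [us ut st sP tP]]] := Lcard i j Lij.
    exists (s, t); split=> // [i'|j'] /=.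
      by rewrite sP LE -(LE i j).1 // ik.
    by rewrite tP LE ik; split=> ->.
  exists ([::], [::]); split=> // [i|j]; split=> // E; case: noi.
    by exists i.
  by have [i /LE Lij] := Ll j; exists i; rewrite Lij.
have {fib}[st stP] := choice fib.
pose h i := nth j0 (st (c i)).2 (index i (st (c i)).1).
pose h' j := nth i0 (st (c' j)).1 (index j (st (c' j)).2).
have ch i : c' (h i) = c i.
  have [us ut st_size sP tP] := stP (c i); apply/tP; rewrite mem_nth //.
  by rewrite -st_size index_mem; apply/sP.
have ch' j : c (h' j) = c' j.
  have [us ut st_size sP tP] := stP (c' j); apply/sP; rewrite mem_nth //.
  by rewrite st_size index_mem; apply/tP.
exists h; split; last by move=> i; apply/LE; rewrite ch.
exists h' => [i|j].
  have [us ut st_size sP tP] := stP (c i).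
  have si : i \in (st (c i)).1 by apply/sP.
  by rewrite /h' ch index_uniq ?nth_index // -st_size index_mem.
have [us ut st_size sP tP] := stP (c' j).
have tj : j \in (st (c' j)).2 by apply/tP.
by rewrite /h ch' index_uniq ?nth_index // st_size index_mem.
Qed.

Section GradedIso.
Context (G : groupoid) (e e' : obj G).
Context (D D' : rngType) (degD : G -> set D) (degD' : G -> set D').
Context (u : D) (u' : D') (lD : local_grdiv degD e u).
Context (lD' : local_grdiv degD' e' u').
Context (I I' : choiceType) (sigma : I -> G) (delta : I' -> G).
Context (cod_sigma : forall i, cod (sigma i) = e).
Context (cod_delta : forall j, cod (delta j) = e').
Local Notation R := (fmx I D).
Local Notation S := (fmx I' D').
Local Notation grR := (fmx_deg degD sigma).
Local Notation grS := (fmx_deg degD' delta).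
Context (f : {additive R -> S}) (g : {additive S -> R}).
Context (fK : cancel f g) (gK : cancel g f).
Context (fM : {morph f : a b / rmul a b}) (gM : {morph g : a b / rmul a b}).
Context (fdeg : forall h a, grR h a -> grS h (f a)).
Context (gdeg : forall h a, grS h a -> grR h (g a)).
Implicit Types (i : I) (j : I').

(** The image of the diagonal unit i is equivalent to the diagonal unit j.
    This relation is what the isomorphism determines about the indices; the
    bijection is chosen inside it. *)
Definition linked i j := dom (delta j) = dom (sigma i) /\
  idem_equiv (grS (idm (dom (sigma i)))) (f (emx i i u)) (emx j j u').

Lemma image_primitive h p : primitive_in (grR h) p -> primitive_in (grS h) (f p).
Proof.
move=> [hp p0 pp pmin]; split.
- exact: fdeg.
- by rewrite -(raddf0 f) (can_eq fK).
- by rewrite -fM pp.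
- move=> q hq qq pq qp q0; rewrite -(gK q); congr (f _); apply: pmin.
  + exact: gdeg.
  + by rewrite -gM qq.
  + by rewrite -{1}(fK p) -gM pq.
  + by rewrite -{1}(fK p) -gM qp.
  + by rewrite -(raddf0 g) (can_eq gK).
Qed.

Lemma linked_total i : exists j, linked i j.
Proof.
have /image_primitive := emx1_primitive lD cod_sigma i.
by move=> /(primitive_equiv lD' cod_delta)[j dj eqj]; exists j.
Qed.

Lemma linked_difunctional i j i' j' :
  linked i j -> linked i' j -> linked i' j' -> linked i j'.
Proof.
move=> [dj ij] [dj' i'j] [dj'' i'j'].
have dii' : dom (sigma i) = dom (sigma i') by rewrite -dj -dj'.
move: i'j i'j'; rewrite -dii' => i'j i'j'; split; first by rewrite dii'.
have CM := fmx_deg_mul_idm lD' (sigma := delta) (f := dom (sigma i)).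
have fE k : rmul (f (emx k k u)) (f (emx k k u)) = f (emx k k u).
  by rewrite -fM (emx1_idem lD).
apply: (idem_equiv_trans CM) i'j'; [exact: fE|exact: (emx1_idem lD')|].
by apply: (idem_equiv_trans CM) (idem_equiv_sym i'j).
Qed.

Lemma linked_size (s : seq I) (t : seq I') i0 j0 : uniq s -> uniq t ->
  linked i0 j0 ->
  (forall i, i \in s -> linked i j0) -> (forall j, linked i0 j -> j \in t) ->
  (size s <= size t)%N.
Proof.
move=> us ut L0 sP tP; have [d0 eq0] := L0.
apply: (orthogonal_card_le lD' cod_delta (p := fun i => f (emx i i u)) us ut d0).
- by move=> i k si sk ik; rewrite -fM emxM0 // raddf0.
- by move=> i si; rewrite -fM (emx1_idem lD).
- by move=> i /sP[di eqi]; rewrite -d0 di.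
- move=> k dk eqk; apply: tP; split=> //.
  apply: (idem_equiv_trans (fmx_deg_mul_idm lD' (f := _))) eq0 eqk.
    by rewrite -fM (emx1_idem lD).
  exact: (emx1_idem lD').
Qed.

(** When i and j are linked through x and k and l are linked through y, the
    corners E_j S E_l and E_i R E_k are identified by z |-> g (x z y).  Their
    elements have a single entry, in D' and in D respectively, and this is the
    map on that entry. *)
Definition transport (x y : S) i k j l (b : D') : D :=
  g (rmul (rmul x (emx j l b)) y) i k.

Section Transport.
Context (i k : I) (j l : I') (xi yi xk yk : S).
Context (dj : dom (delta j) = dom (sigma i)) (dl : dom (delta l) = dom (sigma k)).
Context (fxi : grS (idm (dom (sigma i))) xi).
Context (fyk : grS (idm (dom (sigma k))) yk).
Context (xyi : rmul xi yi = f (emx i i u)) (yxi : rmul yi xi = emx j j u').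
Context (xyk : rmul xk yk = f (emx k k u)) (yxk : rmul yk xk = emx l l u').

Lemma emx_transport b :
  emx i k (transport xi yk i k j l b) = g (rmul (rmul xi (emx j l b)) yk).
Proof.
rewrite /transport -(emx1_corner lD) -{1}(fK (emx i i u)) -(fK (emx k k u)) -!gM.
congr (g _); rewrite -xyi -xyk.
rewrite [emx j l b in RHS](_ : _ = rmul (emx j j u') (rmul (emx j l b) (emx l l u'))).
  by rewrite -yxi -yxk !rmulA.
by rewrite !emxM (grdiv_mul1r lD') (grdiv_mul1l lD').
Qed.

Lemma transport_eq0 b : transport xi yk i k j l b = 0 -> b = 0.
Proof.
move=> T0; have := emx_transport b; rewrite T0 emx0 -(raddf0 g).
move=> /(can_inj gK) /(congr1 (fun z => rmul (rmul yi z) xk)).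
rewrite rmulr0 rmul0r !rmulA yxi -rmulA yxk -rmulA emxM (grdiv_mul1r lD').
rewrite emxM (grdiv_mul1l lD') -(emx0 D' j l).
by move=> /emx_inj.
Qed.

Lemma transportB a b : transport xi yk i k j l (a - b) =
  transport xi yk i k j l a - transport xi yk i k j l b.
Proof. by rewrite /transport emxB rmulBr rmulBl raddfB fmxBE. Qed.

(** Since x and y have identity degrees, only the positions (j, l) and (i, k)
    contribute: degree a at (j, l) is degree delta_j^-1 a delta_l in the matrix
    ring. *)
Lemma transport_deg a b : cod a = e' -> dom a = e' -> degD' a b ->
  degD (gcomp3 (gcomp (sigma i) (ginv (delta j))) a
               (gcomp (delta l) (ginv (sigma k)))) (transport xi yk i k j l b).
Proof.
move=> ca da ab; pose a1 := gcomp3 (ginv (delta j)) a (delta l).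
have cs : composable3 (ginv (delta j)) a (delta l).
  by rewrite /composable3 /composable dom_ginv !cod_delta.
have ca1 : cod a1 = dom (sigma i) by rewrite cod_gcomp3 // cod_ginv.
have da1 : dom a1 = dom (sigma k) by rewrite dom_gcomp3.
have ga1 : grS a1 (emx j l b) by exact: (emx_deg lD' cod_delta).
have : grS a1 (rmul (rmul xi (emx j l b)) yk).
  have := fmx_deg_mul lD' _ fxi ga1; rewrite -ca1 gcomp1m.
  rewrite /composable dom_idm => /(_ erefl) h.
  have := fmx_deg_mul lD' _ h fyk; rewrite -da1 gcompm1; apply.
  by rewrite /composable cod_idm.
move=> /gdeg /fmx_deg_entry -/(_ i k (esym ca1) da1).
by rewrite gcomp3_nest ?dom_ginv ?cod_ginv // cod_gcomp.
Qed.

End Transport.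
End GradedIso.

Lemma additive_of (V W : zmodType) (f : V -> W) :
  (forall a b, f (a - b) = f a - f b) -> exists F : {additive V -> W}, F =1 f.
Proof.
move=> fB; pose F : {additive V -> W} := HB.pack f (GRing.isZmodMorphism.Build V W f fB).
by exists F.
Qed.

Lemma additive_inverse (V W : zmodType) (f : {additive V -> W}) (g : W -> V) :
  cancel f g -> cancel g f -> exists F : {additive W -> V}, F =1 g.
Proof.
move=> fK gK; apply: additive_of => a b.
by apply: (can_inj fK); rewrite raddfB !gK.
Qed.

Section Uniqueness.
Context (G : groupoid) (e e' : obj G).
Context (D D' : rngType) (degD : G -> set D) (degD' : G -> set D').
Context (u : D) (u' : D') (lD : local_grdiv degD e u).
Context (lD' : local_grdiv degD' e' u').
Context (I I' : choiceType) (sigma : I -> G) (delta : I' -> G).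
Context (cod_sigma : forall i, cod (sigma i) = e).
Context (cod_delta : forall j, cod (delta j) = e').
Local Notation grR := (fmx_deg degD sigma).
Local Notation grS := (fmx_deg degD' delta).
Context (f : {additive fmx I D -> fmx I' D'}) (g : {additive fmx I' D' -> fmx I D}).
Context (fK : cancel f g) (gK : cancel g f).
Context (fM : {morph f : a b / rmul a b}) (gM : {morph g : a b / rmul a b}).
Context (fdeg : forall h a, grR h a -> grS h (f a)).
Context (gdeg : forall h a, grS h a -> grR h (g a)).
Implicit Types (i : I) (j : I').
Local Notation link := (linked degD' u u' sigma delta f).

Lemma linked_inverse i j : link i j <-> linked degD u' u delta sigma g j i.
Proof.
split=> -[d [x [y [fx fy xy yx]]]]; rewrite ?d in fx fy; split; rewrite ?d //.
  exists (g y), (g x); split; [exact: gdeg|exact: gdeg| |].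
    by rewrite -gM yx.
  by rewrite -gM xy fK.
exists (f y), (f x); split; [exact: fdeg|exact: fdeg| |].
  by rewrite -fM yx.
by rewrite -fM xy gK.
Qed.

Lemma linked_bijection (i0 : inhabited I) (j0 : inhabited I')
  (fin_sigma : d_finite sigma) (fin_delta : d_finite delta) :
  exists pi : I -> I', bijective pi /\ forall i, link i (pi i).
Proof.
apply: difunctional_bijection => //.
- by move=> i j i' j'; exact: (linked_difunctional lD lD' fM).
- exact: (linked_total lD lD' cod_sigma cod_delta fK gK fM gM fdeg gdeg).
- move=> j; have [i] := linked_total lD' lD cod_delta cod_sigma gK fK gM fM gdeg fdeg j.
  by move=> /linked_inverse; exists i.
move=> i j Lij; have [dj _] := Lij.
have /finite_seqP[s sE] : finite_set [set i' | link i' j].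
  by apply: sub_finite_set (fin_sigma (dom (delta j))) => i' [->].
have /finite_seqP[t tE] : finite_set [set j' | link i j'].
  by apply: sub_finite_set (fin_delta (dom (sigma i))) => j' [].
have sP i' : i' \in undup s <-> link i' j.
  by rewrite mem_undup; have := congr1 (fun A : set I => A i') sE => /= ->.
have tP j' : j' \in undup t <-> link i j'.
  by rewrite mem_undup; have := congr1 (fun A : set I' => A j') tE => /= ->.
exists (undup s), (undup t); split; rewrite ?undup_uniq //.
have us := undup_uniq s; have ut := undup_uniq t.
apply/eqP; rewrite eqn_leq; apply/andP; split.
  by apply: (linked_size lD lD' cod_delta fM us ut Lij) => k /=; [move/sP|move/tP].
apply: (linked_size lD' lD cod_sigma gM ut us ((linked_inverse _ _).1 Lij)) => k.
  by move/tP/linked_inverse.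
by move/linked_inverse/sP.
Qed.

(** Transport sends 1 at position (j, l) to a nonzero element of D of degree
    al = sigma_i delta_j^-1 tau, and delta_j = tau al^-1 sigma_i. *)
Lemma linked_translate i j k l : link i j -> link k l ->
  translate (gcomp (delta l) (ginv (sigma k))) (supp degD) (sigma i) (delta j).
Proof.
move=> [dj [xi [yi [fxi fyi xyi yxi]]]] [dl [xk [yk [fxk fyk xyk yxk]]]].
set tau := gcomp (delta l) _.
have ij : dom (sigma i) = cod (ginv (delta j)) by rewrite cod_ginv.
have lk : dom (delta l) = cod (ginv (sigma k)) by rewrite cod_ginv.
have := transport_deg lD' cod_delta gdeg dj dl fxi fyk
  (cod_idm e') (dom_idm e') (grdiv_one lD').
set al := gcomp3 _ _ _; set b := transport _ _ _ _ _ _ _ _ => al_b.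
have b0 : b != 0.
  apply/negP => /eqP/(transport_eq0 lD lD' fK gK gM xyi yxi xyk yxk)/eqP.
  exact/negP/(grdiv_one_neq0 lD').
have alE : al = gcomp (gcomp (sigma i) (ginv (delta j))) tau.
  rewrite /al /gcomp3; congr gcomp.
  by rewrite -[in RHS](gcompm1 (gcomp _ (ginv (delta j)))) dom_gcomp // dom_ginv cod_delta.
have [b' [al_b' _ bb']] := grdiv_inv lD al_b b0.
have ct : cod tau = e' by rewrite cod_gcomp.
have dt : dom tau = e by rewrite dom_gcomp // dom_ginv.
have st : dom (gcomp (sigma i) (ginv (delta j))) = cod tau.
  by rewrite dom_gcomp // dom_ginv ct.
exists (ginv al); split.
- exists b' => //; apply: contra_neq (grdiv_one_neq0 lD) => b'0.
  by rewrite -bb' b'0 rmul0r.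
- by split; rewrite /composable ?dom_ginv ?cod_ginv alE
    ?(dom_gcomp st) ?(cod_gcomp st) ?(cod_gcomp ij).
- have jV : dom (delta j) = cod (ginv (sigma i)) by rewrite cod_ginv.
  rewrite /gcomp3 alE ginvM // ginvM // ginvK.
  rewrite gcompA ?cod_ginv ?dom_ginv //; last by rewrite cod_gcomp // ct cod_delta.
  rewrite gcompmV ct -(cod_delta j) -(cod_gcomp jV) gcomp1m.
  by have := gcompKm jV; rewrite ginvK.
Qed.

(** For i = k and j = l the transport is a ring isomorphism D' -> D, and
    its effect on degrees is conjugation by tau. *)
Lemma linked_corner_isom k l : link k l ->
  gr_isom degD' (fmx1_deg degD (ginv (gcomp (delta l) (ginv (sigma k))))).
Proof.
move=> [dl [x [y [fx fy xy yx]]]]; set tau := gcomp _ _.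
pose psi b : fmx unit D := emx tt tt (transport g x y k k l l b).
have TE := emx_transport lD lD' fK gM xy yx xy yx.
have [F FE] : exists F : {additive D' -> fmx unit D}, F =1 psi.
  by apply: additive_of => a b; rewrite /psi transportB emxB.
exists F; split.
- (* The inverse is the same construction for f, with x and y exchanged. *)
  pose phi (M : fmx unit D) : D' := rmul (rmul y (f (emx k k (M tt tt)))) x l l.
  exists phi => [b|M]; rewrite FE /phi /psi.
    rewrite emx_diag TE gK !rmulA yx -rmulA yx -rmulA !emxM emx_diag.
    by rewrite (grdiv_mul1r lD') (grdiv_mul1l lD').
  apply: fmxP => -[] []; rewrite emx_diag; set z := rmul _ x.
  apply: (@emx_inj _ _ k k); rewrite TE -(emx1_corner lD') -yx /z.
  set m := emx k k _.
  have -> : rmul (rmul x (rmul (rmul (rmul y x) (rmul (rmul y (f m)) x)) (rmul y x))) y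
      = rmul (rmul (rmul (rmul x y) (rmul x y)) (f m)) (rmul (rmul x y) (rmul x y)).
    by rewrite !rmulA.
  rewrite !xy -!fM fK (emx1_idem lD) /m !emxM.
  by rewrite (grdiv_mul1r lD) (grdiv_mul1l lD).
- move=> a b; rewrite !FE /psi emxM; congr emx.
  apply: (@emx_inj _ _ k k); rewrite TE -(emxM k k) !TE -gM; congr (g _).
  have -> : rmul (rmul (rmul x (emx l l a)) y) (rmul (rmul x (emx l l b)) y)
     = rmul (rmul x (rmul (emx l l a) (rmul (rmul y x) (emx l l b)))) y by rewrite !rmulA.
  by rewrite yx !emxM (grdiv_mul1l lD').
- move=> h a ha s t; rewrite FE; case: s t => -[]; rewrite emx_diag.
  have [->|a0] := eqVneq a 0.
    rewrite (_ : transport _ _ _ _ _ _ _ _ = 0).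
      by apply: (deg3I lD); rewrite eqxx.
    by rewrite /transport emx0 rmulr0 rmul0r raddf0.
  have [ch dh] := grdiv_supp lD' ha a0.
  have := transport_deg lD' cod_delta gdeg dl dl fx fy ch dh ha.
  have lk : dom (delta l) = cod (ginv (sigma k)) by rewrite cod_ginv.
  have ct : cod tau = e' by rewrite cod_gcomp.
  move=> Ta; apply: (deg3I lD) => _; rewrite dom_ginv ct ch dh; split=> //.
  by rewrite ginvK /tau ginvM // ginvK.
Qed.

End Uniqueness.

(** * From a matching of indices to an isomorphism *)

Section ConjugateMatrices.
Context (D D' : rngType) (I I' : choiceType) (h : {additive D -> D'}).
Context (hM : {morph h : a b / rmul a b}).
Context (pi : I -> I') (rho : I' -> I) (rhoK : cancel rho pi) (piK : cancel pi rho).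
Context (p q : I' -> D').

(** The matrix P h(A) Q, for the diagonal matrices P and Q of entries p and q,
    with rows and columns renamed by rho.  The matrices P and Q
    may have infinitely many nonzero entries, so the product is written entrywise. *)
Definition conj_fun (A : fmx I D) : I' -> I' -> D' :=
  fun j k => rmul (rmul (p j) (h (A (rho j) (rho k)))) (q k).

Lemma conj_subproof A : conj_fun A \in @fmx_pred I' D'.
Proof.
apply/asboolP.
have := finite_image (fun ij : I * I => (pi ij.1, pi ij.2)) (fmx_finite A).
apply: sub_finite_set => -[j k] /= nz; exists (rho j, rho k); rewrite /= ?rhoK //.
by apply: contra_neq nz => A0; rewrite /conj_fun A0 raddf0 rmulr0 rmul0r.
Qed.

Definition conj_mx (A : fmx I D) : fmx I' D' := FMx (conj_subproof A).

Lemma conj_mxE A j k :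
  conj_mx A j k = rmul (rmul (p j) (h (A (rho j) (rho k)))) (q k).
Proof. by []. Qed.

Lemma conj_mxB A B : conj_mx (A - B) = conj_mx A - conj_mx B.
Proof.
apply: fmxP => j k; rewrite fmxBE !conj_mxE fmxBE raddfB rmulBr rmulBl.
by [].
Qed.

Lemma conj_mxM (u' : D') : (forall a, rmul u' a = a) ->
  (forall j, rmul (q j) (p j) = u') ->
  {morph conj_mx : A B / rmul A B}.
Proof.
move=> mul1l qp A B; apply: fmxP => j k.
have [s0 sP] := fmx_seqP A; pose s := undup s0; have us : uniq s := undup_uniq s0.
have -> : rmul (conj_mx A) (conj_mx B) j k =
    \sum_(l <- map pi s) rmul (conj_mx A j l) (conj_mx B l k).
  apply: mulfmxE; first by rewrite map_inj_uniq //; exact: can_inj piK.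
  move=> l /andP[nz _]; rewrite -(rhoK l) (mem_map (can_inj piK)) mem_undup.
  apply: (proj2 (sP (rho j) (rho l) _)); apply: contra_neq nz => A0.
  by rewrite conj_mxE A0 raddf0 rmulr0 rmul0r.
rewrite conj_mxE.
have -> : rmul A B (rho j) (rho k) = \sum_(i <- s) rmul (A (rho j) i) (B i (rho k)).
  by apply: mulfmxE => // i /andP[/sP[_ ?] _]; rewrite mem_undup.
rewrite raddf_sum rmul_sumr rmul_suml big_map; apply: eq_bigr => i _.
rewrite hM !conj_mxE piK.
have -> (a b c d m n : D') : rmul (rmul (rmul a b) c) (rmul (rmul d m) n) =
  rmul (rmul a (rmul b (rmul (rmul c d) m))) n by rewrite !rmulA.
by rewrite qp mul1l.
Qed.

End ConjugateMatrices.

Lemma conj_mxK (D D' : rngType) (I I' : choiceType)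
  (h : {additive D -> D'}) (h' : {additive D' -> D})
  (pi : I -> I') (rho : I' -> I) (rhoK : cancel rho pi) (piK : cancel pi rho)
  (p q : I' -> D') (p' q' : I -> D) (u : D) :
  cancel h h' -> {morph h' : a b / rmul a b} ->
  (forall a, rmul u a = a) -> (forall a, rmul a u = a) ->
  (forall i, rmul (p' i) (h' (p (pi i))) = u) ->
  (forall i, rmul (h' (q (pi i))) (q' i) = u) ->
  cancel (conj_mx h rhoK p q) (conj_mx h' piK p' q').
Proof.
move=> hK h'M mul1l mul1r pP qP A; apply: fmxP => i j.
rewrite !conj_mxE !h'M hK !piK !rmulA pP mul1l -rmulA qP.
exact: mul1r.
Qed.

Section Existence.
Context (G : groupoid) (e e' : obj G).
Context (D D' : rngType) (degD : G -> set D) (degD' : G -> set D').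
Context (u : D) (u' : D') (lD : local_grdiv degD e u).
Context (lD' : local_grdiv degD' e' u').
Context (I I' : choiceType) (sigma : I -> G) (delta : I' -> G).
Context (cod_sigma : forall i, cod (sigma i) = e).
Context (cod_delta : forall j, cod (delta j) = e').

Lemma conjugate_division_ring tau : homset e' e tau ->
  gr_isom degD' (fmx1_deg degD (ginv tau)) ->
  exists (h : {additive D -> D'}) (h' : {additive D' -> D}),
    [/\ cancel h h', cancel h' h, {morph h : a b / rmul a b},
        {morph h' : a b / rmul a b} &
        forall g a, cod g = e' -> dom g = e' ->
          degD (gcomp3 (ginv tau) g tau) a -> degD' g (h a)].
Proof.
move=> [ct dt] [F [[F' FK F'K] FM Fdeg]].
have cV (_ : unit) : cod (ginv tau) = e by rewrite cod_ginv.
have F'deg := graded_inverse (grdiv_grading lD') (fmx_grading lD cV) FK F'K Fdeg.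
have unitE (M : fmx unit D) : M = emx tt tt (M tt tt).
  by apply: fmxP => -[] []; rewrite emx_diag.
have [h' h'E] : exists h' : {additive D' -> D}, h' =1 (fun b => F b tt tt).
  by apply: additive_of => a b; rewrite raddfB.
have hK a : F' (emx tt tt (h' a)) = a by rewrite h'E -unitE FK.
have h'K a : h' (F' (emx tt tt a)) = a by rewrite h'E F'K emx_diag.
have [h hE] := additive_inverse hK h'K.
have h'M : {morph h' : a b / rmul a b}.
  move=> a b; apply: (@emx_inj _ _ tt tt); rewrite -(emxM tt tt).
  by rewrite !h'E -!unitE FM.
have hh' : cancel h h' by move=> a; rewrite hE h'K.
have h'h : cancel h' h by move=> a; rewrite hE hK.
exists h, h'; split=> // [a b|g a cg dg ga].
  by apply: (can_inj h'h); rewrite h'M !hh'.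
rewrite hE; apply: F'deg => -[] []; rewrite emx_diag; apply: (deg3I lD) => _.
by rewrite dom_ginv ginvK ct cg dg.
Qed.

(** Write delta_(pi i) = tau a_i sigma_i and choose w_i <> 0 of degree a_i with
    inverse v_i.  The entry w_i A_ij v_j of degree a_i s_i g s_j^-1 a_j^-1
    = tau^-1 (delta_(pi i) g delta_(pi j)^-1) tau is carried by h to the degree
    that the second grading asks for. *)
Lemma matrix_isom_of_translate pi tau : bijective pi -> homset e' e tau ->
  gr_isom degD' (fmx1_deg degD (ginv tau)) ->
  (forall i, translate tau (supp degD) (sigma i) (delta (pi i))) ->
  gr_isom (fmx_deg degD sigma) (fmx_deg degD' delta).
Proof.
move=> [rho piK rhoK] tauP isoD deltaP; have [ct dt] := tauP.
have [h [h' [hK h'K hM h'M hdeg]]] := conjugate_division_ring tauP isoD.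
have u1l := grdiv_mul1l lD; have u1r := grdiv_mul1r lD.
have u1l' := grdiv_mul1l lD'; have u1r' := grdiv_mul1r lD'.
have hu : h u = u' by rewrite -[LHS]u1r' -[u' in LHS]h'K -hM u1l h'K.
have avw i : exists avw : G * D * D, [/\ degD avw.1.1 avw.1.2,
    degD (ginv avw.1.1) avw.2, rmul avw.1.2 avw.2 = u, rmul avw.2 avw.1.2 = u &
    [/\ composable3 tau avw.1.1 (sigma i), cod avw.1.1 = e &
        delta (pi i) = gcomp3 tau avw.1.1 (sigma i)]].
  have [a [[w aw w0] tas dE]] := deltaP i; have [v [av wv vw]] := grdiv_inv lD aw w0.
  by exists (a, w, v); split=> //; split=> //; have [] := grdiv_supp lD aw w0.
have {avw}[avw avwP] := choice avw.
pose a i := (avw i).1.1; pose w i := (avw i).1.2; pose v i := (avw i).2.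
have wv i : rmul (w i) (v i) = u by have [] := avwP i.
have vw i : rmul (v i) (w i) = u by have [] := avwP i.
pose Phi := conj_mx h rhoK (h \o w \o rho) (h \o v \o rho).
pose Psi := conj_mx h' piK v w.
have [F FE] : exists F : {additive fmx I D -> fmx I' D'}, F =1 Phi.
  by apply: additive_of => A B; exact: conj_mxB.
have PhiK : cancel Phi Psi.
  by apply: (conj_mxK _ _ hK h'M u1l u1r) => i /=; rewrite hK piK.
have PsiK : cancel Psi Phi.
  by apply: (conj_mxK _ _ h'K hM u1l' u1r') => j /=; rewrite -hM ?wv ?vw hu.
have PhiM : {morph Phi : A B / rmul A B}.
  by apply: (conj_mxM hM _ piK u1l') => j /=; rewrite -hM vw hu.
exists F; split.
- by exists Psi => A; rewrite FE ?PhiK ?PsiK.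
- by move=> A B; rewrite !FE PhiM.
move=> g A gA; rewrite FE; apply/(fmx_degP lD') => j k.
rewrite conj_mxE /= -!hM; set b := rmul _ _ => hb.
have A0 : A (rho j) (rho k) != 0.
  by apply: contra_neq hb => A0; rewrite /b A0 rmulr0 rmul0r raddf0.
have [sj sk dA] := (fmx_degP lD sigma g A).1 gA _ _ A0.
have [aj _ _ _ [[taj ajs] caj dj]] := avwP (rho j).
have [ak akV _ _ [[tak aks] cak dk]] := avwP (rho k).
rewrite -/(a _) -/(w _) -/(v _) in aj taj ajs caj dj ak akV tak aks cak dk.
rewrite rhoK in dj; rewrite rhoK in dk.
have djd : dom (delta j) = dom (sigma (rho j)) by rewrite dj dom_gcomp3.
have dkd : dom (delta k) = dom (sigma (rho k)) by rewrite dk dom_gcomp3.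
have tV (i : I) : composable tau (a i) -> composable (a i) (sigma i) ->
    forall j, delta j = gcomp3 tau (a i) (sigma i) ->
    gcomp (ginv tau) (delta j) = gcomp (a i) (sigma i).
  by move=> ta as_ l ->; rewrite /gcomp3 -gcompA // gcompKV // cod_gcomp.
have cs : composable3 (sigma (rho j)) g (ginv (sigma (rho k))) by apply/composable3V.
have cd : composable3 (delta j) g (ginv (delta k)).
  by apply/composable3V; rewrite djd dkd.
rewrite djd dkd; split=> //; apply: hdeg.
- by rewrite cod_gcomp3 // cod_delta.
- by rewrite dom_gcomp3 // dom_ginv cod_delta.
have -> : gcomp3 (ginv tau) (gcomp3 (delta j) g (ginv (delta k))) tau
    = gcomp3 (a (rho j)) (gcomp3 (sigma (rho j)) g (ginv (sigma (rho k)))) (ginv (a (rho k))).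
  rewrite !gcomp3_nest ?dom_ginv ?cod_ginv ?cod_delta ?ct //.
  have tkV : dom (ginv tau) = cod (delta k) by rewrite dom_ginv ct cod_delta.
  rewrite (tV _ taj ajs _ dj); congr gcomp3.
  by rewrite -ginvM // -(tV _ tak aks _ dk) ginvM // ginvK.
have cas : cod (gcomp3 (sigma (rho j)) g (ginv (sigma (rho k)))) = cod (sigma (rho j)).
  by rewrite cod_gcomp3.
have das : dom (gcomp3 (sigma (rho j)) g (ginv (sigma (rho k)))) = cod (sigma (rho k)).
  by rewrite dom_gcomp3 // dom_ginv.
rewrite /gcomp3; apply: (grdiv_mul lD) => //.
  by rewrite /composable dom_gcomp ?cod_ginv //; rewrite ?das ?cas //.
by apply: (grdiv_mul lD) => //; rewrite /composable cas.
Qed.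

End Existence.

(** * Classification of graded matrix rings *)

Theorem theorem5p45 (G : groupoid) (e e' : obj G)
  (D D' : rngType) (degD : G -> set D) (degD' : G -> set D')
  (divD : graded_division_ring degD) (divD' : graded_division_ring degD')
  (suppD : supp degD `<=` homset e e) (suppD' : supp degD' `<=` homset e' e')
  (I I' : choiceType) (I_nonempty : inhabited I) (I'_nonempty : inhabited I')
  (sigma : I -> G) (cod_sigma : forall i, cod (sigma i) = e)
  (fin_sigma : d_finite sigma)
  (delta : I' -> G) (cod_delta : forall i, cod (delta i) = e')
  (fin_delta : d_finite delta) :
  gr_isom (fmx_deg degD sigma) (fmx_deg degD' delta) <->
  exists (pi : I -> I') (tau : G),
    [/\ bijective pi,
        homset e' e tau,
        gr_isom degD' (fmx1_deg degD (ginv tau)) &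
        forall i, translate tau (supp degD) (sigma i) (delta (pi i))].
Proof.
have [u lD] := graded_division_ringP divD suppD.
have [u' lD'] := graded_division_ringP divD' suppD'.
split=> [[f [[g0 fK g0K] fM fdeg]]|[pi [tau [pi_bij tauP isoD deltaP]]]]; last first.
  exact: (matrix_isom_of_translate lD lD' cod_delta pi_bij tauP isoD deltaP).
have [g gE] := additive_inverse fK g0K.
have gK : cancel g f by move=> B; rewrite gE g0K.
have {}fK : cancel f g by move=> A; rewrite gE fK.
have gM : {morph g : a b / rmul a b}.
  by move=> A B; apply: (can_inj fK); rewrite fM !gK.
have gdeg := graded_inverse (fmx_grading lD cod_sigma)
  (fmx_grading lD' cod_delta) fK gK fdeg.
have [pi [pi_bij piL]] := linked_bijection lD lD' cod_sigma cod_delta fK gK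
  fM gM fdeg gdeg I_nonempty I'_nonempty fin_sigma fin_delta.
case: I_nonempty => k.
exists pi, (gcomp (delta (pi k)) (ginv (sigma k))).
have [dk _] := piL k; split=> //.
- by split; rewrite ?cod_gcomp ?dom_gcomp ?dom_ginv ?cod_ginv.
- exact: (linked_corner_isom lD lD' cod_delta fK gK fM gM gdeg (piL k)).
- by move=> i; exact: (linked_translate lD lD' cod_sigma cod_delta fK gK gM gdeg
    (piL i) (piL k)).
Qed.
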